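(* Let $c$ be a positive integer and $\mu$ a $c$-core. For all positive rational numbers $x$ and all integers $n\geq 0$, $$\sum_{\lambda\in\operatorname{Par}_\mu^c(n)}t^{h_{x,c}^+(\lambda)}=\sum_{\lambda\in\operatorname{Par}_\mu^c(n)}t^{h_{x,c}^-(\lambda)}.$$
   Context: A partition $\lambda$ of $n=|\lambda|$ is drawn as a Young diagram with $\lambda_i$ unit boxes in row $i$. For a box $\square$, $a(\square)$ is the number of boxes strictly to its right in its row, $l(\square)$ the number strictly above it in its column, and $h(\square)=a(\square)+l(\square)+1$. A rimhook of length $c$ is a connected set of $c$ boxes containing no $2\times 2$ square whose removal leaves a partition diagram. A $c$-core is a partition with no rimhook of length $c$; the $c$-core of $\lambda$ is obtained by repeatedly removing rimhooks of length $c$ (it is well defined). $\operatorname{Par}^c_\mu(n)$ is the set of partitions of $n$ with $c$-core $\mu$. For $x\in[0,\infty]$, $h^+_{x,c}(\lambda)$ counts boxes with $c\mid h(\square)$ and $\frac{a(\square)}{l(\square)+1}\le x<\frac{a(\square)+1}{l(\square)}$; $h^-_{x,c}(\lambda)$ counts boxes with $c\mid h(\square)$ and $\frac{a(\square)}{l(\square)+1}< x\le\frac{a(\square)+1}{l(\square)}$; a fraction with denominator $0$ is $+\infty$. *)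

(* Defs.v *)
From Stdlib Require Import Relation_Operators.
From HB Require Import structures.
From mathcomp Require Import all_boot all_order all_algebra.
From mathcomp Require Import boolp constructive_ereal.

Set Implicit Arguments.
Unset Strict Implicit.
Unset Printing Implicit Defensive.

Import Order.TTheory GRing.Theory Num.Theory.

(* The list of the positive parts, so that [size la] is the number of rows. *)
Definition is_partition (la : seq nat) : bool :=
  sorted geq la && (0 \notin la).

(* Box (i, j) is in row i, column j, both counted from 0.  Diagrams are drawn
   in the French convention: row 0 is at the bottom, so that "above" means a
   larger row index. *)
Definition boxes (la : seq nat) : seq (nat * nat) :=
  [seq (i, j) | i <- iota 0 (size la), j <- iota 0 (nth 0 la i)].

Definition arm (la : seq nat) (b : nat * nat) : nat :=
  count (fun b' => (b'.1 == b.1) && (b.2 < b'.2)) (boxes la).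

Definition leg (la : seq nat) (b : nat * nat) : nat :=
  count (fun b' => (b'.2 == b.2) && (b.1 < b'.1)) (boxes la).

Definition hook (la : seq nat) (b : nat * nat) : nat :=
  (arm la b + leg la b).+1.

(* The two boxes share an edge. *)
Definition adjacent (b b' : nat * nat) : bool :=
  ((b.1 == b'.1) && ((b.2.+1 == b'.2) || (b'.2.+1 == b.2)))
  || ((b.2 == b'.2) && ((b.1.+1 == b'.1) || (b'.1.+1 == b.1))).

Definition box_connected (R : seq (nat * nat)) : Prop :=
  forall b b', b \in R -> b' \in R ->
    exists p, [/\ path adjacent b p, all (mem R) p & last b p = b'].

Definition no_2x2_square (R : seq (nat * nat)) : Prop :=
  forall i j,
    ~~ [&& (i, j) \in R, (i.+1, j) \in R, (i, j.+1) \in R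
         & (i.+1, j.+1) \in R].

(* [R] is a rimhook of length [c] of [la], and its removal leaves [nu]. *)
Definition rimhook_removal (c : nat) (la : seq nat) (R : seq (nat * nat))
    (nu : seq nat) : Prop :=
  [/\ uniq R /\ size R = c, {subset R <= boxes la},
      box_connected R, no_2x2_square R
    & is_partition nu /\ boxes nu =i [seq b <- boxes la | b \notin R]].

Definition removes_rimhook (c : nat) (la nu : seq nat) : Prop :=
  exists R, rimhook_removal c la R nu.

Definition is_core (c : nat) (mu : seq nat) : Prop :=
  is_partition mu /\ ~ exists nu, removes_rimhook c mu nu.

Definition has_core (c : nat) (la mu : seq nat) : Prop :=
  clos_refl_trans _ (removes_rimhook c) la mu /\ is_core c mu.

Record partn (n : nat) := Partn {
  parts :> seq nat;
  _ : is_partition parts && (sumn parts == n) }.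

HB.instance Definition _ n := [isSub for @parts n].
HB.instance Definition _ n := [Countable of partn n by <:].

(* A partition of n has at most n parts, each at most n: every one arises from
   an n-tuple by dropping its zeros. *)
Definition partn_enum (n : nat) : seq (partn n) :=
  undup (pmap insub [seq [seq k <- map val t | 0 < k]
                    | t : n.-tuple 'I_n.+1 <- enum {: n.-tuple 'I_n.+1}]).

Lemma size_le_sumn (s : seq nat) : 0 \notin s -> size s <= sumn s.
Proof.
elim: s => //= k s IHs; rewrite inE negb_or eq_sym -lt0n => /andP[k0 /IHs].
by rewrite -add1n; apply: leq_add.
Qed.

Lemma le_sumn (s : seq nat) k : k \in s -> k <= sumn s.
Proof.
elim: s => //= k' s IHs; rewrite inE => /orP[/eqP->|/IHs]; first exact: leq_addr.
by move=> /leq_trans; apply; apply: leq_addl.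
Qed.

Lemma partn_enumP n : Finite.axiom (partn_enum n).
Proof.
move=> la; rewrite count_uniq_mem ?undup_uniq // mem_undup mem_pmap_sub /=.
case: la => la /= /andP[/andP[_ la0] /eqP sla]; apply/eqP; rewrite eqb1.
have le_size : size la <= n by rewrite -sla size_le_sumn.
pose s := la ++ nseq (n - size la) 0.
have size_s : size [seq inord k : 'I_n.+1 | k <- s] == n.
  by rewrite size_map size_cat size_nseq subnKC.
apply/mapP; exists (Tuple size_s); first by rewrite mem_enum.
rewrite /= -map_comp.
have -> : [seq (val \o (fun k => inord k : 'I_n.+1)) k | k <- s] = s.
  rewrite -[RHS]map_id; apply/eq_in_map => k /=.
  rewrite mem_cat => /orP[/le_sumn|/nseqP[-> _]]; last by rewrite inordK.
  by rewrite sla => le_kn; rewrite inordK.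
rewrite filter_cat filter_nseq /= cats0.
symmetry; apply/all_filterP/allP => k k_la; rewrite lt0n.
by apply: contraNneq la0 => <-.
Qed.

HB.instance Definition _ n := isFinite.Build (partn n) (@partn_enumP n).

Local Open Scope ring_scope.
Local Open Scope ereal_scope.

Definition frac (p q : nat) : \bar rat :=
  if q == 0%N then +oo else (p%:R / q%:R)%:E.

Definition hplus (x : \bar rat) (c : nat) (la : seq nat) : nat :=
  count (fun b => [&& (c %| hook la b)%N,
                      frac (arm la b) (leg la b).+1 <= x
                    & x < frac (arm la b).+1 (leg la b)]) (boxes la).

Definition hminus (x : \bar rat) (c : nat) (la : seq nat) : nat :=
  count (fun b => [&& (c %| hook la b)%N,
                      frac (arm la b) (leg la b).+1 < x
                    & x <= frac (arm la b).+1 (leg la b)]) (boxes la).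

Definition Par (c : nat) (mu : seq nat) (n : nat) : {set partn n} :=
  [set la : partn n | `[< has_core c la mu >]].

(* Main.v *)
Require Import Defs.
From Stdlib Require Import Relation_Operators.
From HB Require Import structures.
From mathcomp Require Import all_boot all_order all_algebra.
From mathcomp Require Import fingroup perm.
From mathcomp Require Import ring zify.
From mathcomp Require Import boolp constructive_ereal.

Set Implicit Arguments.
Unset Strict Implicit.
Unset Printing Implicit Defensive.

Import Order.TTheory GRing.Theory Num.Theory.
Local Open Scope ring_scope.

(* Read the boundary of a partition, from its topmost row to its bottom row, as a
   word in east and south steps.  The boxes are the pairs of an east step [i]
   and a later south step [j]; arm and leg count the east and south steps
   strictly in between, and the hook length is [j - i].  For [x = r / s], give
   the point with [u] east steps behind it and [v] south steps ahead of it the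
   level [s * u + r * v], and call vertex the pair of its level and of its time
   modulo [c].  Then [hplus] and [hminus] have a common part, to which [hplus]
   adds the pairs of steps arriving at the same vertex and [hminus] those leaving
   the same vertex.

   Fix how many steps of either kind leave each vertex.  This fixes the size of
   the partition and its core (the number of south steps at each time modulo
   [c]), and also the common part: a pair counted there is a downward crossing of
   the path with one of its translates, and downward and upward crossings
   alternate.  What is left is a statement on Eulerian tours.  By induction on the
   number of steps, the generating function of the tours by exit inversions is a
   product of [t]-factorials times a minor of a [t]-deformed Laplacian.  The entry
   inversions are the exit inversions of the reversed tour, and the Laplacian of
   the latter is the transpose of a diagonal conjugate of the first one. *)

(** * Determinants over a finite index type *)

Section FinDet.
Variables (K : fieldType) (V : finType).
Implicit Types f g : V -> V -> K.

Definition fdet f : K :=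
  \det (\matrix_(i < #|V|, j < #|V|) f (enum_val i) (enum_val j)).

Lemma fdetE f : fdet f = \sum_(s : {perm 'I_#|V|}) (-1) ^+ s *
  \prod_i f (enum_val i) (enum_val (s i)).
Proof.
by apply: eq_bigr => s _; congr (_ * _); apply: eq_bigr => i _; rewrite mxE.
Qed.

Lemma eq_fdet f g : f =2 g -> fdet f = fdet g.
Proof. by move=> fg; congr (\det _); apply/matrixP => i j; rewrite !mxE fg. Qed.

Lemma fdet_row v f f1 f2 k k1 k2 :
  (forall x y, x != v -> f1 x y = f x y) ->
  (forall x y, x != v -> f2 x y = f x y) ->
  (forall y, k * f v y = k1 * f1 v y + k2 * f2 v y) ->
  k * fdet f = k1 * fdet f1 + k2 * fdet f2.
Proof.
move=> h1 h2 h; rewrite !fdetE !big_distrr -big_split; apply: eq_bigr => s _ /=.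
have split_v f' : \prod_i f' (enum_val i) (enum_val (s i)) =
    f' v (enum_val (s (enum_rank v))) *
    \prod_(i < #|V| | i != enum_rank v) f' (enum_val i) (enum_val (s i)).
  by rewrite (bigD1 (enum_rank v)) //= enum_rankK.
have eqP f' : (forall x y, x != v -> f' x y = f x y) ->
    \prod_(i < #|V| | i != enum_rank v) f' (enum_val i) (enum_val (s i)) =
    \prod_(i < #|V| | i != enum_rank v) f (enum_val i) (enum_val (s i)).
  move=> eqf; apply: eq_bigr => i ne; rewrite eqf //.
  by apply: contraNneq ne => <-; rewrite enum_valK.
rewrite !split_v (eqP _ h1) (eqP _ h2); set P := \prod_(_ < _ | _) _.
set j := enum_val (s _).
move: (_ ^+ s) => e.
rewrite [LHS](_ : _ = e * (k * f v j) * P); last by ring.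
rewrite h; ring.
Qed.

(** A permutation moving [v] picks an off-diagonal entry of column [v], which is zero for [f] and
    hence for [g]. The other permutations see row [v] only at its diagonal entry. *)
Lemma fdet_unit_col v f g :
  (forall x y, x != v -> f x y = g x y) -> f v v = g v v ->
  (forall x, x != v -> f x v = 0) -> fdet f = fdet g.
Proof.
move=> fg fgv fv; rewrite !fdetE; apply: eq_bigr => s _; congr (_ * _).
have [sv|sv] := eqVneq (s (enum_rank v)) (enum_rank v).
  apply: eq_bigr => i _; have [->|ne] := eqVneq i (enum_rank v).
    by rewrite sv enum_rankK.
  by apply: fg; apply: contraNneq ne => <-; rewrite enum_valK.
pose i := (s^-1)%g (enum_rank v).
have si : enum_val (s i) = v by rewrite /i permKV enum_rankK.
have iv : enum_val i != v.
  apply: contra_neq sv => iv; rewrite -[X in s X](_ : i = _) ?permKV //.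
  by rewrite -iv enum_valK.
rewrite (bigD1 i) //= [RHS](bigD1 i) //= si -fg // fv //.
by rewrite !mul0r.
Qed.

Lemma fdet_ker (z : V -> K) v f :
  z v != 0 -> (forall x, \sum_y f x y * z y = 0) -> fdet f = 0.
Proof.
move=> zv fz; rewrite /fdet -det_tr; apply/eqP/det0P.
exists (\row_i z (enum_val i)).
  apply: contra_neq zv => /matrixP/(_ 0 (enum_rank v)).
  by rewrite !mxE enum_rankK.
apply/matrixP => i j; rewrite !mxE -[RHS](fz (enum_val j)).
rewrite [RHS](reindex_onto enum_val enum_rank) => [|y _]; last exact: enum_rankK.
apply: eq_big => [k|k _]; first by rewrite enum_valK eqxx.
by rewrite !mxE mulrC.
Qed.

(** Away from [o], [g] is the transpose of [f] conjugated by the diagonal matrix [h]. Match each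
    permutation with its inverse: those moving [o] contribute zero because row [o] is a unit row,
    and in the others the factors [h] are merely permuted and cancel. *)
Lemma fdet_conj_tr o (h : V -> K) f g :
  (forall x, h x != 0) ->
  (forall y, f o y = (o == y)%:R) -> (forall y, g o y = (o == y)%:R) ->
  (forall x y, x != o -> y != o -> g y x * h x = f x y * h y) ->
  fdet f = fdet g.
Proof.
move=> h0 fo go fg; rewrite !fdetE [RHS](reindex_inj invg_inj) /=.
apply: eq_bigr => s _; rewrite odd_permV; congr (_ * _).
rewrite [RHS](reindex_inj (@perm_inj _ s)) /=.
under [RHS]eq_bigr => i _ do rewrite permK.
pose k := enum_rank o.
have ok : enum_val k = o by rewrite enum_rankK.
have nk i : i != k -> enum_val i != o.
  by apply: contraNneq => eo; rewrite /k -eo enum_valK.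
have [sk|sk] := eqVneq (s k) k; last first.
  rewrite (bigD1 k) //= ok fo eq_sym (negbTE (nk _ sk)) mul0r.
  pose j := (s^-1)%g k; have sj : s j = k by rewrite /j permKV.
  rewrite (bigD1 j) //= sj ok go eq_sym.
  have jk : j != k by apply: contra_neq sk => jk; rewrite -[X in s X]jk.
  by rewrite (negbTE (nk _ jk)) mul0r.
have hp : \prod_(i < #|V|) h (enum_val i) != 0 by apply/prodf_neq0.
apply: (mulIf hp); rewrite [X in X = _]mulrC.
rewrite [X in X * _](reindex_inj (@perm_inj _ s)) -!big_split /=.
apply: eq_bigr => i _.
have [->|ik] := eqVneq i k; first by rewrite sk ok fo go mulrC.
have sik : s i != k by apply: contra_neq ik => sik; apply: (@perm_inj _ s); rewrite sk.
by rewrite fg ?nk // mulrC.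
Qed.

End FinDet.

(** * The [t]-analogues of integers and factorials *)

Section QuantumIntegers.
Variables (K : fieldType) (t : K).

Definition qint k : K := \sum_(i < k) t ^+ i.
Definition qfact k : K := \prod_(i < k) qint i.+1.

Lemma qint0 : qint 0 = 0. Proof. by rewrite /qint big_ord0. Qed.
Lemma qint1 : qint 1 = 1. Proof. by rewrite /qint big_ord1. Qed.

Lemma qintD a b : qint (a + b) = qint a + t ^+ a * qint b.
Proof.
rewrite /qint big_split_ord /= big_distrr; congr (_ + _).
by apply: eq_bigr => i _; rewrite exprD.
Qed.

Lemma qfactS k : qfact k.+1 = qfact k * qint k.+1.
Proof. by rewrite /qfact big_ord_recr. Qed.

Lemma qfact0 : qfact 0 = 1. Proof. by rewrite /qfact big_ord0. Qed.
End QuantumIntegers.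

(** * Walks and their exit inversions *)

Lemma big_tuple_cons (R : nmodType) (T : finType) n (P : pred (seq T)) (F : seq T -> R) :
  \sum_(w : n.+1.-tuple T | P w) F w =
  \sum_(l : T) \sum_(w : n.-tuple T | P (l :: w)) F (l :: w).
Proof.
rewrite (reindex (fun p : T * n.-tuple T => cons_tuple p.1 p.2)) /=; last first.
  exists (fun w : n.+1.-tuple T => (thead w, [tuple of behead w])) => [[l w]|w] _ /=.
    by rewrite theadE; congr (_, _); apply: val_inj.
  by rewrite [RHS]tuple_eta; apply: val_inj.
by rewrite pair_big_dep /=.
Qed.

Section Walks.
Variables (V : zmodType) (al be : V).
Implicit Types (v x y o : V) (w : seq bool) (l : bool).

(* In a word, [false] is an east step and [true] a south step. *)
Definition step l : V := if l then be else al.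

Definition pos v w i : V := foldl (fun x l => x + step l) v (take i w).

(** Steps are attributed to the vertex they leave, so the final position contributes nothing. *)
Definition cnt l v w x : nat :=
  (\sum_(i < size w) ((nth false w i == l) && (pos v w i == x)))%N.

Definition exit_inv v w : nat :=
  (\sum_(j < size w) \sum_(i < size w)
    [&& i < j, ~~ nth false w i, nth false w j & pos v w i == pos v w j])%N.

Lemma pos0 v w : pos v w 0 = v. Proof. by rewrite /pos take0. Qed.

Lemma posS v w i : (i < size w)%N ->
  pos v w i.+1 = pos v w i + step (nth false w i).
Proof. by move=> iw; rewrite /pos (take_nth false) // foldl_rcons. Qed.

Lemma cnt_nil l v x : cnt l v [::] x = 0%N.
Proof. by rewrite /cnt big_ord0. Qed.

Lemma cnt_cons l v l' w x :
  cnt l v (l' :: w) x = ((l' == l) && (v == x) + cnt l (v + step l') w x)%N.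
Proof. by rewrite /cnt /= big_ord_recl /= pos0. Qed.

Lemma exit_inv_cons v l w : exit_inv v (l :: w) =
  ((if l then 0 else cnt true (v + step l) w v) + exit_inv (v + step l) w)%N.
Proof.
rewrite /exit_inv /= big_ord_recl /= big1 ?add0n; last first.
  by move=> i _.
under eq_bigr => j _ do rewrite big_ord_recl /=.
rewrite big_split /=; congr (_ + _)%N.
rewrite /cnt; case: l; first by rewrite big1.
by apply: eq_bigr => j _; rewrite pos0 eq_sym eqb_id.
Qed.

(** Both sides count the visits to [x]: each one is the start or is entered by a step, and each one
    is the end or is left by a step. *)
Lemma cnt_flow v w x :
  (cnt false v w (x - al) + cnt true v w (x - be) + (x == v) =
   cnt false v w x + cnt true v w x + (x == pos v w (size w)))%N.
Proof.
elim: w v => [|l w IHw] v; first by rewrite !cnt_nil /pos.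
rewrite !cnt_cons.
have -> : pos v (l :: w) (size (l :: w)) = pos (v + step l) w (size w) by [].
have := IHw (v + step l); rewrite [v == x]eq_sym.
have -> : (x == v + step l) = (v == x - step l) by rewrite -subr_eq eq_sym.
by case: l => /=; lia.
Qed.

End Walks.

(** * A [t]-deformed count of walks with prescribed exits *)

Section WalkCount.
Variables (K : fieldType) (t : K) (V : finZmodType).
Hypothesis qint_neq0 : forall k, qint t k.+1 != 0.
Variables (al be o : V).
Implicit Types (v x y : V) (w : seq bool) (a b : V -> nat).
Notation step := (step al be).
Notation pos := (pos al be).
Notation cnt := (cnt al be).
Notation exit_inv := (exit_inv al be).

Definition has_cnt a b v w :=
  [forall x, (cnt false v w x == a x) && (cnt true v w x == b x)].

Definition walk_gf N a b v : K :=
  \sum_(w : N.-tuple bool | has_cnt a b v w) t ^+ exit_inv v w.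

Definition decr a v x : nat := (a x - (x == v))%N.

(** The conservation law [cnt_flow] for exit numbers of a walk from [v] to [o]. *)
Definition balanced a b v :=
  forall x, (a (x - al)%R + b (x - be)%R + (x == v) = a x + b x + (x == o))%N.

(** The weights [qint t p] and [t ^+ p * qint t q] of the two kinds of exits add up to the diagonal
    weight, by [qintD]. The root and the vertices without exits get a unit row, so [fdet] of the
    whole is the minor obtained by deleting them. *)
Definition laplacian_row p q x y : K :=
  if (x == o) || (p + q == 0)%N then (x == y)%:R
  else qint t (p + q) * (y == x)%:R - qint t p * (y == x + al)%:R
       - t ^+ p * qint t q * (y == x + be)%:R.

Definition laplacian a b x y := laplacian_row (a x) (b x) x y.

(** As in the BEST theorem, all exits but the last are freely ordered, and at the root all of them
    are. The denominator is there because exits of the same kind are indistinguishable. *)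
Definition vertex_factor (r : bool) p q : K :=
  (if r then qfact t (p + q) else qfact t (p + q).-1) / (qfact t p * qfact t q).

Definition prefactor a b := \prod_x vertex_factor (x == o) (a x) (b x).

Lemma qfact_neq0 k : qfact t k != 0.
Proof. by rewrite /qfact; apply/prodf_neq0. Qed.

Lemma decrE a v x : x != v -> decr a v x = a x.
Proof. by rewrite /decr => /negbTE->; rewrite subn0. Qed.

Lemma decr_self a v : decr a v v = (a v).-1.
Proof. by rewrite /decr eqxx subn1. Qed.

Lemma has_cnt_false a b v w :
  has_cnt a b v (false :: w) = (0 < a v)%N && has_cnt (decr a v) b (v + al) w.
Proof.
apply/forallP/andP => [h|[av /forallP h] x].
  split; first by have /andP[/eqP<- _] := h v; rewrite cnt_cons !eqxx.
  apply/forallP => x; have /andP[/eqP ha /eqP hb] := h x.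
  apply/andP; split; apply/eqP; last by rewrite -hb cnt_cons.
  by rewrite /decr -ha cnt_cons eqxx /= eq_sym addKn.
have /andP[/eqP ha /eqP hb] := h x.
rewrite !cnt_cons /= hb eqxx andbT ha /decr [x == v]eq_sym.
by apply/eqP; move: av; case: eqVneq => [->|_]; lia.
Qed.

Lemma has_cnt_true a b v w :
  has_cnt a b v (true :: w) = (0 < b v)%N && has_cnt a (decr b v) (v + be) w.
Proof.
apply/forallP/andP => [h|[bv /forallP h] x].
  split; first by have /andP[_ /eqP<-] := h v; rewrite cnt_cons !eqxx.
  apply/forallP => x; have /andP[/eqP ha /eqP hb] := h x.
  apply/andP; split; apply/eqP; first by rewrite -ha cnt_cons.
  by rewrite /decr -hb cnt_cons eqxx /= eq_sym addKn.
have /andP[/eqP ha /eqP hb] := h x.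
rewrite !cnt_cons /= ha eqxx /= hb /decr [x == v]eq_sym.
by apply/eqP; move: bv; case: eqVneq => [->|_]; lia.
Qed.

(** Split on the first step: an east step out of [v] forms an exit inversion with each of the [b v]
    later south steps out of [v]. *)
Lemma walk_gfS N a b v : walk_gf N.+1 a b v =
  (0 < a v)%:R * t ^+ b v * walk_gf N (decr a v) b (v + al) +
  (0 < b v)%:R * walk_gf N a (decr b v) (v + be).
Proof.
rewrite /walk_gf (big_tuple_cons N (has_cnt a b v) (fun w => t ^+ exit_inv v w)).
rewrite big_bool [LHS]addrC /=.
congr (_ + _).
  under eq_bigl => w do rewrite has_cnt_false.
  case: (0 < a v)%N; last by rewrite big_pred0_eq !mul0r.
  rewrite mul1r big_distrr; apply: eq_bigr => w /forallP/(_ v)/andP[_ /eqP hb].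
  by rewrite exit_inv_cons hb exprD.
under eq_bigl => w do rewrite has_cnt_true.
case: (0 < b v)%N; last by rewrite big_pred0_eq !mul0r.
by rewrite mul1r; apply: eq_bigr => w _; rewrite exit_inv_cons.
Qed.

(** Makes the determinant, linear in row [v], obey the recurrence of [walk_gfS]. The coefficients of
    the three targets are compared by splitting a [t]-integer with [qintD]. *)
Lemma laplacian_row_rec p q v y : v != o -> (1 < p + q)%N ->
  qint t (p + q).-1 * laplacian_row p q v y =
  t ^+ q * qint t p * laplacian_row p.-1 q v y + qint t q * laplacian_row p q.-1 v y.
Proof.
move=> vo; rewrite /laplacian_row (negbTE vo) /=.
case: p q => [|p] [|q] //.
- by rewrite !add0n qint0 /= => /eqP; case: q => //= q _; ring.
- by rewrite !addn0 qint0 /=; case: p => //= p _; ring.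
rewrite addSn /= addnS /= => _.
have e0 : qint t (p + q).+2 = qint t q.+1 + t ^+ q.+1 * qint t p.+1.
  by rewrite -qintD; congr qint; lia.
have e1 : qint t (p + q).+1 = qint t q.+1 + t ^+ q.+1 * qint t p.
  by rewrite -qintD; congr qint; lia.
have e2 : qint t (p + q).+1 = qint t q + t ^+ q * qint t p.+1.
  by rewrite -qintD; congr qint; lia.
set D := (y == v)%:R; set E := (y == v + al)%:R; set S := (y == v + be)%:R.
have c0 : qint t (p + q).+1 * qint t (p + q).+2 =
    t ^+ q.+1 * qint t p.+1 * qint t (p + q).+1
    + qint t q.+1 * qint t (p + q).+1.
  by rewrite e0; ring.
have c1 : qint t (p + q).+1 * qint t p.+1 =
    t ^+ q.+1 * qint t p.+1 * qint t p + qint t q.+1 * qint t p.+1.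
  by rewrite e1; ring.
have c2 : qint t (p + q).+1 * (t ^+ p.+1 * qint t q.+1) =
    t ^+ q.+1 * qint t p.+1 * (t ^+ p * qint t q.+1)
    + qint t q.+1 * (t ^+ p.+1 * qint t q).
  by rewrite e2 !exprS; ring.
rewrite !mulrBr !mulrA -[_ * t ^+ p.+1 * _]mulrA c0 c1 c2.
ring.
Qed.

(** At the root the factor is a [t]-binomial coefficient, and this is its Pascal rule. *)
Lemma vertex_factor_root p q : (0 < p + q)%N -> vertex_factor true p q =
  (0 < p)%:R * t ^+ q * vertex_factor true p.-1 q
  + (0 < q)%:R * vertex_factor true p q.-1.
Proof.
rewrite /vertex_factor; case: p q => [|p] [|q] //.
- by move=> _; rewrite !add0n !qfact0 /= qfactS; field; rewrite !qfact_neq0 qint_neq0.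
- by move=> _; rewrite !addn0 !qfact0 /= !qfactS; field; rewrite !qfact_neq0 qint_neq0.
move=> _; rewrite addSn addnS /= !qfactS.
have -> : qint t (p + q).+2 = qint t q.+1 + t ^+ q.+1 * qint t p.+1.
  by rewrite -qintD; congr qint; lia.
field.
by rewrite !qfact_neq0 !qint_neq0.
Qed.

Lemma vertex_factor_decr_a p q : (1 < p + q)%N ->
  qint t (p + q).-1 * ((0 < p)%:R * vertex_factor false p.-1 q) =
  qint t p * vertex_factor false p q.
Proof.
rewrite /vertex_factor; case: p => [|p] /= ; first by rewrite qint0 !mul0r mulr0.
rewrite addSn /= ltnS => /ltn_predK <-; rewrite !qfactS mul1r; field.
by rewrite !qfact_neq0 !qint_neq0.
Qed.

Lemma vertex_factor_decr_b p q : (1 < p + q)%N ->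
  qint t (p + q).-1 * ((0 < q)%:R * vertex_factor false p q.-1) =
  qint t q * vertex_factor false p q.
Proof.
rewrite /vertex_factor; case: q => [|q] /= ; first by rewrite qint0 !mul0r mulr0.
rewrite addnS /= ltnS => /ltn_predK <-; rewrite !qfactS mul1r; field.
by rewrite !qfact_neq0 !qint_neq0.
Qed.

Lemma prefactorE a b v : prefactor a b =
  vertex_factor (v == o) (a v) (b v) *
  \prod_(x | x != v) vertex_factor (x == o) (a x) (b x).
Proof. by rewrite /prefactor (bigD1 v). Qed.

Lemma prefactor_decr_a a b v : prefactor (decr a v) b =
  vertex_factor (v == o) (a v).-1 (b v) *
  \prod_(x | x != v) vertex_factor (x == o) (a x) (b x).
Proof.
rewrite (prefactorE _ _ v) decr_self; congr (_ * _).
by apply: eq_bigr => x xv; rewrite decrE.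
Qed.

Lemma prefactor_decr_b a b v : prefactor a (decr b v) =
  vertex_factor (v == o) (a v) (b v).-1 *
  \prod_(x | x != v) vertex_factor (x == o) (a x) (b x).
Proof.
rewrite (prefactorE _ _ v) decr_self; congr (_ * _).
by apply: eq_bigr => x xv; rewrite decrE.
Qed.

Lemma laplacian_decr_a a b v x y : x != v ->
  laplacian (decr a v) b x y = laplacian a b x y.
Proof. by move=> xv; rewrite /laplacian decrE. Qed.

Lemma laplacian_decr_b a b v x y : x != v ->
  laplacian a (decr b v) x y = laplacian a b x y.
Proof. by move=> xv; rewrite /laplacian decrE. Qed.

Lemma balanced_decr_a a b v :
  (0 < a v)%N -> balanced a b v -> balanced (decr a v) b (v + al).
Proof.
move=> av bal x; have := bal x; rewrite /decr.
have -> : (x - al == v) = (x == v + al) by rewrite subr_eq.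
have [xv|xv] := eqVneq x v; have [xal|xal] := eqVneq x (v + al);
  rewrite ?[in a (x - al)]xal ?addrK; try subst x; lia.
Qed.

Lemma balanced_decr_b a b v :
  (0 < b v)%N -> balanced a b v -> balanced a (decr b v) (v + be).
Proof.
move=> bv bal x; have := bal x; rewrite /decr.
have -> : (x - be == v) = (x == v + be) by rewrite subr_eq.
have [xv|xv] := eqVneq x v; have [xbe|xbe] := eqVneq x (v + be);
  rewrite ?[in b (x - be)]xbe ?addrK; try subst x; lia.
Qed.

Lemma sum_decr a v : (0 < a v)%N -> (\sum_x a x = (\sum_x decr a v x).+1)%N.
Proof.
move=> av; rewrite (bigD1 v) //= [in RHS](bigD1 v) //= decr_self -addSn prednK //.
by congr (_ + _)%N; apply: eq_bigr => x xv; rewrite decrE.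
Qed.

Lemma sum_delta (k : K) c (z : V -> K) : \sum_y k * (y == c)%:R * z y = k * z c.
Proof.
rewrite (bigD1 c) //= eqxx mulr1 big1 ?addr0 // => y /negbTE->.
by rewrite mulr0 mul0r.
Qed.

(* The indicator of the vertices that still have an outgoing edge is then a
   nonzero kernel vector of the Laplacian. *)
Lemma fdet_laplacian_degenerate a b x : balanced a b o ->
  (a o + b o = 0)%N -> (0 < a x + b x)%N -> fdet (laplacian a b) = 0.
Proof.
move=> bal o0 x0; pose z y : K := (0 < a y + b y)%N%:R.
have zal y : (0 < a y)%N -> z (y + al) = 1.
  by move=> ay; rewrite /z; have := bal (y + al); rewrite addrK; case: posnP => //; lia.
have zbe y : (0 < b y)%N -> z (y + be) = 1.
  by move=> ay; rewrite /z; have := bal (y + be); rewrite addrK; case: posnP => //; lia.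
apply: (@fdet_ker _ _ z x); first by rewrite /z x0 oner_neq0.
move=> y; rewrite /laplacian /laplacian_row.
have [->|yo] /= := eqVneq y o.
  under eq_bigr => u _ do rewrite eq_sym -[(u == o)%:R]mul1r.
  by rewrite sum_delta mul1r /z o0.
have [y0|y0] := eqVneq (a y + b y)%N 0%N.
  under eq_bigr => u _ do rewrite eq_sym -[(u == y)%:R]mul1r.
  by rewrite sum_delta mul1r /z y0.
under eq_bigr => u _ do rewrite !mulrBl.
rewrite !sumrB !sum_delta.
have -> : z y = 1 by rewrite /z lt0n y0.
have -> : qint t (a y) * z (y + al) = qint t (a y).
  by have [->|/zal->] := posnP (a y); rewrite ?qint0 ?mul0r ?mulr1.
have -> : t ^+ a y * qint t (b y) * z (y + be) = t ^+ a y * qint t (b y).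
  by have [->|/zbe->] := posnP (b y); rewrite ?qint0 ?mulr0 ?mul0r ?mulr1.
by rewrite qintD; ring.
Qed.

(** The walk stands at [v] with a single exit left, so by balance no remaining step enters [v].
    Column [v] is then zero off the diagonal, and row [v] may be replaced by a unit row. *)
Lemma fdet_last_exit a b a' b' v : balanced a b v -> v != o ->
  (a v + b v = 1)%N -> (a' v + b' v = 0)%N ->
  {in predC1 v, a =1 a'} -> {in predC1 v, b =1 b'} ->
  fdet (laplacian a b) = fdet (laplacian a' b').
Proof.
move=> bal vo ab1 ab0 ha hb; have := bal v; rewrite eqxx (negbTE vo) => balv.
have a0 : a (v - al) = 0%N by lia.
have b0 : b (v - be) = 0%N by lia.
have nal : v = v + al -> a v = 0%N.
  by move=> /eqP; rewrite -subr_eq => /eqP e; rewrite -a0 e.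
have nbe : v = v + be -> b v = 0%N.
  by move=> /eqP; rewrite -subr_eq => /eqP e; rewrite -b0 e.
apply: (@fdet_unit_col _ _ v).
- by move=> x y xv; rewrite /laplacian ha ?hb.
- rewrite /laplacian /laplacian_row (negbTE vo) ab0 ab1 /= eqxx qint1 !mulr1.
  have [/nal->|_] := eqVneq v (v + al); last first.
    have [/nbe->|_] := eqVneq v (v + be); last first.
      rewrite /=; ring.
    by rewrite qint0 /=; ring.
  have [/nbe->|_] := eqVneq v (v + be); by rewrite ?qint0 /=; ring.
- move=> x xv; rewrite /laplacian /laplacian_row [x == v]eq_sym [v == x]eq_sym (negbTE xv).
  case: ifP => // _.
  have [e|_] := eqVneq v (x + al).
    have -> : a x = 0%N by rewrite -a0 e addrK.
    rewrite qint0; have [e'|_] := eqVneq v (x + be); last by rewrite /=; ring.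
    have -> : b x = 0%N by rewrite -b0 e' addrK.
    by rewrite qint0 /=; ring.
  have [e'|_] := eqVneq v (x + be); last by rewrite /=; ring.
  have -> : b x = 0%N by rewrite -b0 e' addrK.
  by rewrite qint0 /=; ring.
Qed.

(** A [t]-analogue of the BEST theorem, by induction through the first step. *)
Theorem walk_gfE N a b v : balanced a b v -> (\sum_x a x + \sum_x b x = N)%N ->
  walk_gf N a b v = prefactor a b * fdet (laplacian a b).
Proof.
elim: N a b v => [|N IHN] a b v bal sumN.
  have a0 x : a x = 0%N.
    by apply/eqP; rewrite -leqn0; move: sumN; rewrite (bigD1 x) //=; lia.
  have b0 x : b x = 0%N.
    by apply/eqP; rewrite -leqn0; move: sumN; rewrite addnC (bigD1 x) //=; lia.
  rewrite /walk_gf (big_pred1 [tuple]) => [|w]; last first.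
    rewrite (tuple0 w) [RHS]eqxx; apply/forallP => x.
    by rewrite !cnt_nil a0 b0.
  rewrite /exit_inv big_ord0 expr0 /prefactor big1 ?mul1r => [|x _]; last first.
    by rewrite /vertex_factor a0 b0 !qfact0 mulr1 divr1; case: ifP; rewrite ?qfact0.
  rewrite /fdet -[LHS](det1 K #|V|); congr (\det _); apply/matrixP => i j.
  by rewrite !mxE /laplacian /laplacian_row a0 b0 orbT (inj_eq enum_val_inj).
rewrite walk_gfS.
(* Without an exit at [v], balance forces [v = o]. Steps remain elsewhere but cannot be reached, and
   the determinant vanishes too. *)
have [n0|n0] := posnP (a v + b v)%N.
  have /andP[/eqP a0 /eqP b0] : (a v == 0%N) && (b v == 0%N) by lia.
  have vo : v = o by apply/eqP; have := bal v; rewrite eqxx; case: eqP => //; lia.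
  rewrite a0 b0 !mul0r addr0; case: (pickP (fun x => 0 < a x + b x)%N) => [x x0|all0].
    by subst v; rewrite (fdet_laplacian_degenerate bal n0 x0) mulr0.
  move: sumN; rewrite -big_split big1 //= => x _; apply/eqP.
  by rewrite -leqn0 leqNgt all0.
have IHa : (0 < a v)%N -> walk_gf N (decr a v) b (v + al) =
    prefactor (decr a v) b * fdet (laplacian (decr a v) b).
  by move=> av; apply: IHN; [exact: balanced_decr_a | have := sum_decr av; lia].
have IHb : (0 < b v)%N -> walk_gf N a (decr b v) (v + be) =
    prefactor a (decr b v) * fdet (laplacian a (decr b v)).
  by move=> bv; apply: IHN; [exact: balanced_decr_b | have := sum_decr bv; lia].
rewrite (_ : _%:R * _ * _ = (0 < a v)%:R * t ^+ b v *
    (prefactor (decr a v) b * fdet (laplacian (decr a v) b))); last first.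
  by case: posnP => [_|/IHa->//]; rewrite !mul0r.
rewrite (_ : _%:R * walk_gf _ _ _ _ = (0 < b v)%:R *
    (prefactor a (decr b v) * fdet (laplacian a (decr b v)))); last first.
  by case: posnP => [_|/IHb->//]; rewrite !mul0r.
rewrite (prefactorE a b v) prefactor_decr_a prefactor_decr_b.
set C0 := \prod_(x | x != v) _.
(* The row of the root does not depend on its exits, so only the vertex factor changes. *)
have [vo|vo] := eqVneq v o.
  have -> : fdet (laplacian (decr a v) b) = fdet (laplacian a b).
    apply: eq_fdet => x y; have [->|xv] := eqVneq x v; last by rewrite laplacian_decr_a.
    by rewrite /laplacian /laplacian_row vo eqxx.
  have -> : fdet (laplacian a (decr b v)) = fdet (laplacian a b).
    apply: eq_fdet => x y; have [->|xv] := eqVneq x v; last by rewrite laplacian_decr_b.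
    by rewrite /laplacian /laplacian_row vo eqxx.
  by rewrite (vertex_factor_root n0); ring.
have [n1|n1] := leqP (a v + b v) 1.
  have : (a v == 1%N) && (b v == 0%N) || (a v == 0%N) && (b v == 1%N) by lia.
  case/orP => /andP[/eqP a1 /eqP b1].
    rewrite -(@fdet_last_exit a b (decr a v) b v) ?a1 ?b1 ?decr_self ?a1 //; last first.
      by move=> x xv; rewrite decrE.
    by rewrite /vertex_factor /= addn0 /= !qfactS !qfact0 qint1; field; rewrite oner_neq0.
  rewrite -(@fdet_last_exit a b a (decr b v) v) ?a1 ?b1 ?decr_self ?b1 //; last first.
    by move=> x xv; rewrite decrE.
  by rewrite /vertex_factor /= !qfactS !qfact0 qint1; field; rewrite oner_neq0.
(* At least two exits are left, so the factor carried by [laplacian_row_rec] can be cancelled. *)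
have nz : qint t (a v + b v).-1 != 0.
  by move: n1; case: (a v + b v)%N => [|[|k]] //= _.
apply: (mulfI nz); symmetry.
have rec : qint t (a v + b v).-1 * fdet (laplacian a b) =
    t ^+ b v * qint t (a v) * fdet (laplacian (decr a v) b)
    + qint t (b v) * fdet (laplacian a (decr b v)).
  apply: (@fdet_row _ _ v) => [x y xv|x y xv|y].
  - exact: laplacian_decr_a.
  - exact: laplacian_decr_b.
  - by rewrite /laplacian !decr_self laplacian_row_rec.
have ca := vertex_factor_decr_a n1; have cb := vertex_factor_decr_b n1.
transitivity (vertex_factor false (a v) (b v) * C0 *
  (qint t (a v + b v).-1 * fdet (laplacian a b))).
  by ring.
rewrite rec.
transitivity (t ^+ b v * fdet (laplacian (decr a v) b) * C0 *
    (qint t (a v) * vertex_factor false (a v) (b v))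
  + fdet (laplacian a (decr b v)) * C0 *
    (qint t (b v) * vertex_factor false (a v) (b v))).
  by ring.
by rewrite -ca -cb; ring.
Qed.
End WalkCount.

(** * Reversing a walk *)

(** Negating the letters keeps an east step before a south step in that order after reversal; the
    step vectors become [- be] for east and [- al] for south. *)
Definition flip (w : seq bool) := map negb (rev w).

Lemma size_flip w : size (flip w) = size w.
Proof. by rewrite size_map size_rev. Qed.

Lemma flipK : involutive flip.
Proof. by move=> w; rewrite /flip -map_rev revK mapK //; exact: negbK. Qed.

Lemma nth_flip w i : (i < size w)%N ->
  nth false (flip w) i = ~~ nth false w (size w - i.+1).
Proof. by move=> iw; rewrite (nth_map false) ?size_rev // nth_rev. Qed.

Section Flip.
Variables (V : zmodType) (al be : V).
Implicit Types (v x : V) (w : seq bool).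

Definition entry_inv v w : nat :=
  (\sum_(j < size w) \sum_(i < size w)
    [&& i < j, ~~ nth false w i, nth false w j
      & pos al be v w i.+1 == pos al be v w j.+1])%N.

Lemma pos_flip v w i : (i <= size w)%N ->
  pos (- be) (- al) (pos al be v w (size w)) (flip w) i =
  pos al be v w (size w - i).
Proof.
elim: i => [|i IHi] iw; first by rewrite pos0 subn0.
rewrite posS ?size_flip // IHi 1?ltnW // nth_flip //.
rewrite -subnSK // posS; last by lia.
by rewrite /step; case: (nth _ _ _) => /=; rewrite addrK.
Qed.

(** A reversed step leaves the vertex that the original step entered, whence the shift of [x]. *)
Lemma cnt_flip l v w x :
  cnt (- be) (- al) l (pos al be v w (size w)) (flip w) x =
  cnt al be (~~ l) v w (x - step al be (~~ l)).
Proof.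
rewrite /cnt size_flip (reindex_inj rev_ord_inj) /=; apply: eq_bigr => i _.
have lti := ltn_ord i.
rewrite nth_flip ?pos_flip; try lia.
have e1i : (size w - (size w - i.+1).+1 = i)%N by lia.
have e2i : (size w - (size w - i.+1) = i.+1)%N by lia.
rewrite ?e1i ?e2i.
rewrite posS // -[in RHS]subr_eq opprK.
case: eqVneq => [<-|ne]; first by rewrite negbK eqxx.
by case: l ne; case: (nth _ _ _).
Qed.

Lemma exit_inv_flip v w :
  exit_inv (- be) (- al) (pos al be v w (size w)) (flip w) = entry_inv v w.
Proof.
rewrite /exit_inv /entry_inv size_flip exchange_big /=.
rewrite (reindex_inj rev_ord_inj) /=; apply: eq_bigr => j _.
rewrite (reindex_inj rev_ord_inj) /=; apply: eq_bigr => i _.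
have lti := ltn_ord i; have ltj := ltn_ord j.
rewrite !nth_flip ?pos_flip; try lia.
have e1i : (size w - (size w - i.+1).+1 = i)%N by lia.
have e2i : (size w - (size w - i.+1) = i.+1)%N by lia.
rewrite ?e1i ?e2i.
have e1j : (size w - (size w - j.+1).+1 = j)%N by lia.
have e2j : (size w - (size w - j.+1) = j.+1)%N by lia.
rewrite ?e1j ?e2j.
have -> : (size w - j.+1 < size w - i.+1)%N = (i < j)%N by lia.
rewrite negbK [pos _ _ _ _ i.+1 == _]eq_sym.
by case: (nth _ _ i); case: (nth _ _ j).
Qed.
End Flip.

Definition tflip N (w : N.-tuple bool) := [tuple of map negb (rev w)].

Lemma tflipK N : involutive (@tflip N).
Proof. by move=> w; apply: val_inj; exact: (flipK w). Qed.

(** * Equidistribution of exit and entry inversions *)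

Section EntryExit.
Variables (K : fieldType) (t : K) (V : finZmodType).
Hypothesis qint_neq0 : forall k, qint t k.+1 != 0.
Hypothesis t_neq0 : t != 0.
Implicit Types (x y v o : V) (e d : V -> nat).

Lemma balanced_walk al be v w :
  balanced al be (pos al be v w (size w)) (cnt al be false v w) (cnt al be true v w) v.
Proof. by move=> x; rewrite cnt_flow. Qed.

Lemma has_cntP al be a b v w :
  reflect (cnt al be false v w =1 a /\ cnt al be true v w =1 b)
          (has_cnt al be a b v w).
Proof.
apply: (iffP forallP) => [h|[ha hb] x]; last by rewrite ha hb !eqxx.
by split=> x; have /andP[/eqP ha /eqP hb] := h x.
Qed.

Lemma has_cnt_end al be a b v o w :
  balanced al be o a b v -> has_cnt al be a b v w ->
  pos al be v w (size w) = o.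
Proof.
move=> bal /has_cntP[ha hb]; apply/eqP; rewrite eq_sym.
have := cnt_flow al be v w o; rewrite !ha !hb => /(etrans (esym (bal o))).
by rewrite eqxx; case: (o == pos _ _ _ _ _) => //; lia.
Qed.

Lemma has_cnt_flip al be e d o w : pos al be o w (size w) = o ->
  has_cnt al be e d o w ->
  has_cnt (- be) (- al) (fun x => d (x - be)) (fun x => e (x - al)) o (flip w).
Proof.
move=> wo /has_cntP[he hd]; apply/has_cntP; rewrite -wo.
by split=> x; rewrite cnt_flip /= ?he ?hd.
Qed.

(** Reversal is an involution: the converse of [has_cnt_flip] is the same implication for the
    reversed data, where the shifts cancel. *)
Lemma has_cnt_flipE al be e d o w : balanced al be o e d o ->
  has_cnt (- be) (- al) (fun x => d (x - be)) (fun x => e (x - al)) o (flip w) =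
  has_cnt al be e d o w.
Proof.
move=> bal; apply/idP/idP => h; last first.
  by apply: has_cnt_flip => //; exact: has_cnt_end h.
have bal' : balanced (- be) (- al) o (fun x => d (x - be)) (fun x => e (x - al)) o.
  by move=> x; rewrite !opprK !addrK; have := bal x; lia.
have := has_cnt_flip (has_cnt_end bal' h) h; rewrite flipK !opprK.
move=> /has_cntP[h1 h2]; apply/has_cntP.
by split=> x; rewrite ?h1 ?h2 addrK.
Qed.

(** The numerators agree because as many steps enter a vertex as leave it; in the denominators the
    shifts only permute the factors. *)
Lemma prefactor_flip al be e d o : balanced al be o e d o ->
  prefactor t o e d =
  prefactor t o (fun x => d (x - be)) (fun x => e (x - al)).
Proof.
move=> bal; rewrite /prefactor /vertex_factor !big_split /=; congr (_ * _).
  apply: eq_bigr => x _; have -> // : (e x + d x = d (x - be)%R + e (x - al)%R)%N.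
  by have := bal x; lia.
rewrite !prodfV; congr (_^-1); rewrite !big_split /= mulrC; congr (_ * _).
  by rewrite (reindex_inj (addIr (- be))).
by rewrite (reindex_inj (addIr (- al))).
Qed.

(* [G] is a discrete potential: conjugation by the diagonal matrix with entries
   [t ^+ G x] turns the exit Laplacian into the transpose of the entry one. *)
Lemma fdet_laplacian_flip al be e d o (G : V -> nat) : balanced al be o e d o ->
  (forall x, (0 < e x)%N -> G (x + al) = (G x + d (x + al - be)%R)%N) ->
  (forall x, (0 < d x)%N -> G x = (G (x + be)%R + e x)%N) ->
  fdet (laplacian t al be o e d) =
  fdet (laplacian t (- be) (- al) o (fun x => d (x - be)) (fun x => e (x - al))).
Proof.
move=> bal Gal Gbe.
have bal' x : (d (x - be)%R + e (x - al)%R = e x + d x)%N by have := bal x; lia.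
apply: (@fdet_conj_tr _ _ o (fun x => t ^+ G x)) => [x|y|y|x y xo yo].
- by rewrite expf_neq0.
- by rewrite /laplacian /laplacian_row eqxx.
- by rewrite /laplacian /laplacian_row eqxx.
rewrite /laplacian /laplacian_row (negbTE xo) (negbTE yo) !bal' /=.
have [x0|x0] := eqVneq (e x + d x)%N 0%N.
  have [ex dx] : e x = 0%N /\ d x = 0%N by lia.
  have [<-|xy] := eqVneq x y; first by rewrite x0 eqxx.
  case: ifP => _; first by rewrite /= !mul0r.
  have [e1|_] := eqVneq x (y - be).
    rewrite -e1 dx qint0; have [e2|_] := eqVneq x (y - al).
      by rewrite -e2 ex qint0 /=; ring.
    by rewrite /=; ring.
  have [e2|_] := eqVneq x (y - al).
    by rewrite -e2 ex qint0 /=; ring.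
  by rewrite /=; ring.
have [y0|y0] := eqVneq (e y + d y)%N 0%N.
  have [ey dy] : e (y - al) = 0%N /\ d (y - be) = 0%N by have := bal' y; lia.
  have [xy|xy] := eqVneq y x; first by rewrite -xy y0 in x0.
  have [e1|_] := eqVneq y (x + al).
    have -> : e x = 0%N by rewrite -ey e1 addrK.
    rewrite qint0; have [e2|_] := eqVneq y (x + be).
      by have -> : d x = 0%N; rewrite ?qint0 /=; [rewrite -dy e2 addrK|ring].
    by rewrite /=; ring.
  have [e2|_] := eqVneq y (x + be).
    by have -> : d x = 0%N; rewrite ?qint0 /=; [rewrite -dy e2 addrK|ring].
  by rewrite /=; ring.
have hE : t ^+ d (y - be) * qint t (e (y - al)) * (x == y - al)%:R * t ^+ G x =
    qint t (e x) * (y == x + al)%:R * t ^+ G y.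
  rewrite [x == y - al]eq_sym subr_eq; have [->|_] := eqVneq y (x + al); last first.
    by rewrite !mulr0 !mul0r.
  rewrite addrK; have [->|/Gal->] := posnP (e x); first by rewrite qint0; ring.
  by rewrite exprD; ring.
have hS : qint t (d (y - be)) * (x == y - be)%:R * t ^+ G x =
    t ^+ e x * qint t (d x) * (y == x + be)%:R * t ^+ G y.
  rewrite [x == y - be]eq_sym subr_eq; have [->|_] := eqVneq y (x + be); last first.
    by rewrite !mulr0 !mul0r.
  rewrite addrK; have [->|/Gbe->] := posnP (d x); first by rewrite qint0; ring.
  by rewrite exprD; ring.
rewrite !mulrBl hE hS addrAC; congr (_ - _ - _).
by rewrite eq_sym; have [->|_] := eqVneq y x; rewrite /= ?mulr0 ?mul0r.
Qed.

Lemma sum_cnt al be l v w : (\sum_x cnt al be l v w x = count_mem l w)%N.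
Proof.
elim: w v => [|l' w IHw] v; first by rewrite big1 // => x _; rewrite cnt_nil.
under eq_bigr => x _ do rewrite cnt_cons.
rewrite big_split IHw /=; congr (_ + _)%N.
rewrite (bigD1 v) //= eqxx andbT big1 ?addn0 // => x /negbTE xv.
by rewrite [v == x]eq_sym xv andbF.
Qed.

(** Both sums are evaluated by [walk_gfE], the second one after reversing all walks;
    [prefactor_flip] and [fdet_laplacian_flip] identify the values. *)
Theorem exit_entry_equidistributed al be o N (w0 : N.-tuple bool) (G : V -> nat)
    (e := cnt al be false o w0) (d := cnt al be true o w0) :
  pos al be o w0 N = o ->
  (forall x, (0 < e x)%N -> G (x + al) = (G x + d (x + al - be)%R)%N) ->
  (forall x, (0 < d x)%N -> G x = (G (x + be)%R + e x)%N) ->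
  \sum_(w : N.-tuple bool | has_cnt al be e d o w) t ^+ exit_inv al be o w =
  \sum_(w : N.-tuple bool | has_cnt al be e d o w) t ^+ entry_inv al be o w.
Proof.
move=> w0o Gal Gbe.
have bal : balanced al be o e d o.
  by have := balanced_walk al be o w0; rewrite size_tuple w0o.
have sumN : (\sum_x e x + \sum_x d x = N)%N.
  rewrite !sum_cnt -[RHS](size_tuple w0) -(count_predC (pred1 false)); congr (_ + _)%N.
  by apply: eq_count; case.
rewrite -/(walk_gf _ _ _ _ _ _ _) (walk_gfE qint_neq0 bal sumN).
rewrite (prefactor_flip bal) (fdet_laplacian_flip bal Gal Gbe).
rewrite -(@walk_gfE _ _ _ qint_neq0 _ _ _ N _ _ o) //.
- rewrite /walk_gf (reindex_inj (inv_inj (@tflipK N))) /=; apply: eq_big => w.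
    by rewrite has_cnt_flipE.
  by rewrite has_cnt_flipE // => /(has_cnt_end bal) wo; rewrite -{1}wo exit_inv_flip.
- by move=> x; rewrite !opprK !addrK; have := bal x; lia.
- rewrite -sumN addnC (reindex_inj (addIr al)) /=.
  rewrite [X in (_ + X)%N](reindex_inj (addIr be)) /=.
  by congr (_ + _)%N; apply: eq_bigr => x _; rewrite addrK.
Qed.
End EntryExit.

(** * Lattice paths as walks on a torus *)

Section Potential.
Variables (V : finZmodType) (al be o : V) (e d : V -> nat) (T : nat).

(** The east exits along the ray from [x] in direction [be], truncated because directions close up
    in a finite group. *)
Definition potential x : nat := (\sum_(k < T.+1) e (x + be *+ k)%R)%N.

Lemma potential_be x : e (x + be *+ T.+1) = 0%N ->
  potential x = (potential (x + be)%R + e x)%N.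
Proof.
move=> eT; rewrite /potential big_ord_recl big_ord_recr /= mulr0n addr0 addnC.
rewrite -[x + be + _]addrA -mulrS eT addn0; congr (_ + _)%N.
by apply: eq_bigr => k _; rewrite -[x + be + _]addrA -mulrS.
Qed.

(** Add the balance equations along the ray from [x + al]: the south terms telescope, and the far
    one is zero. *)
Lemma potential_al x : balanced al be o e d o -> d (x + al + be *+ T) = 0%N ->
  potential (x + al) = (potential x + d (x + al - be)%R)%N.
Proof.
move=> bal dT; apply: (@addIn (\sum_(k < T.+1) d (x + al + be *+ k)%R)%N).
rewrite /potential -big_split /=.
transitivity (\sum_(k < T.+1) (e (x + be *+ k)%R + d (x + al - be + be *+ k)%R))%N.
  apply: eq_bigr => k _; have := bal (x + al + be *+ k).
  rewrite (_ : x + al + be *+ k - al = x + be *+ k); last by rewrite addrAC addrK.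
  rewrite (_ : x + al + be *+ k - be = x + al - be + be *+ k); last by rewrite addrAC.
  by move=> /addIn h; exact: esym h.
rewrite big_split /= -addnA; congr (_ + _)%N.
rewrite big_ord_recl mulr0n addr0 big_ord_recr /= dT addn0; congr (_ + _)%N.
by apply: eq_bigr => k _; rewrite mulrS addrA subrK.
Qed.
End Potential.

HB.instance Definition _ (U W : finZmodType) := GRing.Zmodule.on (U * W)%type.

Definition easts (w : seq bool) j := count negb (take j w).
Definition souths (w : seq bool) j := count id (drop j w).

Lemma easts0 w : easts w 0 = 0%N. Proof. by rewrite /easts take0. Qed.

Lemma eastsS w j : (j < size w)%N -> easts w j.+1 = (easts w j + ~~ nth false w j)%N.
Proof. by move=> jw; rewrite /easts (take_nth false) // -cats1 count_cat /= addn0. Qed.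

Lemma southsS w j : (j < size w)%N -> souths w j = (souths w j.+1 + nth false w j)%N.
Proof. by move=> jw; rewrite /souths (drop_nth false) //= addnC. Qed.

Lemma souths0 w : souths w 0 = count id w. Proof. by rewrite /souths drop0. Qed.

Lemma souths_size w : souths w (size w) = 0%N. Proof. by rewrite /souths drop_size. Qed.

Lemma easts_size w : easts w (size w) = count negb w. Proof. by rewrite /easts take_size. Qed.

Section Levels.
Variables (s r : nat).
Definition level w j := (s * easts w j + r * souths w j)%N.

Lemma levelS w j : (j < size w)%N ->
  (level w j.+1 + r * nth false w j = level w j + s * ~~ nth false w j)%N.
Proof. by move=> jw; rewrite /level eastsS // [souths w j]southsS //; lia. Qed.
End Levels.

Section Torus.
Variables (s r K C : nat).
Let V := ('I_K.+1 * 'I_C.+1)%type.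

(** Level and time. Reducing the time modulo [C.+1] is essential; reducing the level only makes the
    vertex set finite. *)
Definition vertex l j : V := (inZp l, inZp j).
Definition torus_east : V := vertex s 1.
Definition torus_south : V := vertex 0 1 - vertex r 0.

Lemma vertexD l l' j j' : vertex l j + vertex l' j' = vertex (l + l') (j + j').
Proof. by congr (_, _); apply: val_inj => /=; rewrite modnDm. Qed.

Lemma inZp_inj n l l' : (l <= n)%N -> (l' <= n)%N ->
  (inZp l == inZp l' :> 'I_n.+1) = (l == l').
Proof.
by move=> ln ln'; rewrite -val_eqE /= !modn_small.
Qed.

Lemma pos_torus w j : (j <= size w)%N ->
  pos torus_east torus_south (vertex (level s r w 0) 0) w j = vertex (level s r w j) j.
Proof.
elim: j => [|j IHj] jw; first by rewrite pos0.
rewrite posS // IHj 1?ltnW //; have := levelS s r jw.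
rewrite /step; case: (nth false w j) => /= e.
  rewrite (_ : level s r w j = level s r w j.+1 + r)%N; last by lia.
  rewrite (_ : vertex (_ + r) j = vertex (level s r w j.+1) j + vertex r 0); last first.
    by rewrite vertexD addn0.
  by rewrite /torus_south addrACA addrN addr0 vertexD addn0 addn1.
rewrite (_ : level s r w j.+1 = level s r w j + s)%N; last by lia.
by rewrite -[j.+1]addn1 -vertexD.
Qed.

Lemma vertex_eq l l' j j' : (l <= K)%N -> (l' <= K)%N ->
  (vertex l j == vertex l' j') = (l == l') && (j == j' %[mod C.+1])%N.
Proof. by move=> lK lK'; rewrite /vertex xpair_eqE inZp_inj // -val_eqE. Qed.

Lemma torus_south_mul k : torus_south *+ k = vertex 0 k - vertex (r * k) 0.
Proof.
elim: k => [|k IHk]; first by rewrite mulr0n muln0 subrr.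
rewrite mulrSr IHk /torus_south addrACA vertexD -opprD vertexD addn1 mulnSr.
by [].
Qed.
End Torus.

Lemma cnt_gt0P (V : zmodType) (al be : V) l v w x : (0 < cnt al be l v w x)%N ->
  exists2 j, (j < size w)%N & nth false w j = l /\ pos al be v w j = x.
Proof.
rewrite lt0n sum_nat_eq0 negb_forall => /existsP[j].
rewrite implyTb eqb0 negbK => /andP[/eqP h1 /eqP h2].
by exists j.
Qed.

Lemma cnt_gt0 (V : zmodType) (al be : V) v w j : (j < size w)%N ->
  (0 < cnt al be (nth false w j) v w (pos al be v w j))%N.
Proof. by move=> jw; rewrite /cnt (bigD1 (Ordinal jw)) //= !eqxx. Qed.

(** Grouping the steps by the vertex they leave shows that such a sum depends on the exit numbers
    alone. *)
Lemma sum_over_walk (V : finZmodType) (al be : V) l v w (f : V -> nat) :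
  (\sum_(j < size w) (nth false w j == l) * f (pos al be v w j)
   = \sum_x cnt al be l v w x * f x)%N.
Proof.
under [RHS]eq_bigr => x _ do rewrite /cnt big_distrl.
rewrite exchange_big; apply: eq_bigr => j _ /=.
rewrite (bigD1 (pos al be v w j)) //= eqxx andbT big1 ?addn0 // => x xj.
by rewrite [_ == x]eq_sym (negbTE xj) andbF.
Qed.

Lemma count_id_negb w : (count id w + count negb w = size w)%N.
Proof. exact: count_predC. Qed.

(** * Closed tours on the torus and their classes *)

Section Tours.
Variables (s r C L : nat).
Hypotheses (s_gt0 : (0 < s)%N) (r_gt0 : (0 < r)%N).
(* With these bounds the levels of a path that stays below [L] do not wrap
   around the torus. *)
Local Notation T := (L + s + 1)%N.
Local Notation K := (L + r * T.+1 + s)%N.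
Notation al := (torus_east s K C).
Notation be := (torus_south r K C).
Notation o := (vertex K C L 0).
Notation lvl := (level s r).

(** Makes the path a closed tour at [o], on which the level can be recovered from the vertex. *)
Definition bounded w := [/\ (C.+1 %| size w)%N, lvl w 0 = L, lvl w (size w) = L
  & forall j, (j <= size w)%N -> (lvl w j <= L)%N].

Definition same_tour w0 w :=
  has_cnt al be (cnt al be false o w0) (cnt al be true o w0) o w.

Definition tour_key w :=
  ([ffun x => cnt al be false o w x], [ffun x => cnt al be true o w x]).

Lemma tour_keyE w w0 : (tour_key w == tour_key w0) = same_tour w0 w.
Proof.
apply/eqP/has_cntP => [[/ffunP e1 /ffunP e2]|[e1 e2]].
  by split=> y; [have := e1 y | have := e2 y]; rewrite !ffunE.
by congr (_, _); apply/ffunP => y; rewrite !ffunE.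
Qed.

Definition exit_stat w := (\sum_(j < size w) \sum_(i < size w)
  [&& i < j, ~~ nth false w i, nth false w j
    & (lvl w i == lvl w j) && (i == j %[mod C.+1])])%N.

Definition entry_stat w := (\sum_(j < size w) \sum_(i < size w)
  [&& i < j, ~~ nth false w i, nth false w j
    & (lvl w i.+1 == lvl w j.+1) && (i == j %[mod C.+1])])%N.

Let LK : (L <= K)%N. Proof. lia. Qed.
Let L2K : (L + L <= K)%N. Proof. nia. Qed.

Lemma pos_level w j : lvl w 0 = L -> (j <= size w)%N ->
  pos al be o w j = vertex K C (lvl w j) j.
Proof. by move=> w0 jw; rewrite -pos_torus // w0. Qed.

Lemma pos_bounded w j : bounded w -> (j <= size w)%N ->
  pos al be o w j = vertex K C (lvl w j) j.
Proof. by case=> _ w0 _ _; exact: pos_level. Qed.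

Lemma exit_invE w : bounded w -> exit_inv al be o w = exit_stat w.
Proof.
move=> bw; have [_ _ _ ub] := bw.
apply: eq_bigr => j _; apply: eq_bigr => i _.
have li := ltn_ord i; have lj := ltn_ord j.
have {}li := ltnW li; have {}lj := ltnW lj.
by rewrite !pos_bounded // vertex_eq //; apply: leq_trans LK; apply: ub.
Qed.

Lemma entry_invE w : bounded w -> entry_inv al be o w = entry_stat w.
Proof.
move=> bw; have [_ _ _ ub] := bw.
apply: eq_bigr => j _; apply: eq_bigr => i _.
have li := ltn_ord i; have lj := ltn_ord j.
rewrite !pos_bounded // vertex_eq; last 2 first.
- by apply: leq_trans LK; apply: ub.
- by apply: leq_trans LK; apply: ub.
by rewrite -[i.+1]addn1 -[j.+1]addn1 eqn_modDr.
Qed.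

Lemma same_tour_visit w0 w x l : same_tour w0 w ->
  cnt al be l o w x = cnt al be l o w0 x.
Proof. by move=> /has_cntP[h1 h2]; case: l. Qed.

Lemma same_tour_count w0 w : same_tour w0 w -> count id w = count id w0.
Proof.
move=> st; have e w' : count id w' = count_mem true w'.
  by apply: eq_count => -[].
rewrite !e -!(sum_cnt al be true o); apply: eq_bigr => x _.
exact: same_tour_visit.
Qed.

(** The end levels depend only on the numbers of steps, and each vertex left by [w] is also left by
    [w0], where the level is at most [L]. *)
Lemma same_tour_bounded w0 w : size w = size w0 -> same_tour w0 w ->
  bounded w0 -> bounded w.
Proof.
move=> sz st bw0; have [c0 level0 levelN ub0] := bw0.
have cid := same_tour_count st.
have cneg : count negb w = count negb w0.
  by have := count_id_negb w; have := count_id_negb w0; lia.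
have level_w0 : lvl w 0 = L by rewrite -level0 /level !easts0 !souths0 cid.
have level_wN : lvl w (size w) = L.
  by rewrite -levelN /level !souths_size !easts_size cneg.
split=> // [|j]; first by rewrite sz.
rewrite leq_eqVlt => /predU1P[->|jw]; first by rewrite level_wN.
have := cnt_gt0 al be o jw; rewrite (same_tour_visit _ _ st) => /cnt_gt0P[i iw0 [_]].
have {}iw0 := ltnW iw0; have {}jw := ltnW jw.
rewrite (pos_bounded bw0) // (pos_level level_w0) // => /eqP; rewrite vertex_eq.
- by move=> /andP[/eqP<- _]; apply: ub0.
- by apply: leq_trans LK; apply: ub0.
(* A priori each term of a level of [w] is bounded by one of the two end levels, so the level is at
   most [L + L], which still does not wrap. *)
apply: leq_trans L2K.
rewrite -[X in (_ <= X + _)%N]level_wN -[X in (_ <= _ + X)%N]level_w0.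
rewrite /level easts0 souths0 easts_size souths_size !muln0 add0n addn0.
apply: leq_add; rewrite leq_mul2l /easts /souths.
  by rewrite -[X in (_ <= count _ X)%N](cat_take_drop j) count_cat leq_addr orbT.
by rewrite -[X in (_ <= count _ X)%N](cat_take_drop j) count_cat leq_addl orbT.
Qed.

(** Level and residue of the time are functions of the vertex, so [sum_over_walk] applies. This
    yields the invariance of the size, of the core and, for pairs, of crossings. *)
Lemma same_tour_sum w0 w l (f : nat -> nat -> nat) : size w = size w0 ->
  same_tour w0 w -> bounded w0 ->
  (\sum_(j < size w) (nth false w j == l) * f (lvl w j) (j %% C.+1) =
   \sum_(j < size w0) (nth false w0 j == l) * f (lvl w0 j) (j %% C.+1))%N.
Proof.
move=> sz st bw0; have bw := same_tour_bounded sz st bw0.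
have e w' : bounded w' ->
  (\sum_(j < size w') (nth false w' j == l) * f (lvl w' j) (j %% C.+1) =
   \sum_x cnt al be l o w' x * f (val x.1) (val x.2))%N.
  move=> bw'; rewrite -sum_over_walk; apply: eq_bigr => j _.
  have lj := ltn_ord j; have [_ _ _ ub] := bw'.
  rewrite pos_bounded 1?ltnW //= [(lvl w' j %% _)%N]modn_small //.
  by rewrite ltnS; apply: leq_trans LK; apply: ub; exact: ltnW.
by rewrite !e //; apply: eq_bigr => x _; rewrite (same_tour_visit _ _ st).
Qed.

Lemma same_tour_sum2 w0 w (f : nat -> nat -> nat -> nat -> nat) :
  size w = size w0 -> same_tour w0 w -> bounded w0 ->
  (\sum_(j < size w) \sum_(i < size w) (nth false w j && ~~ nth false w i) *
     f (lvl w i) (i %% C.+1) (lvl w j) (j %% C.+1) =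
   \sum_(j < size w0) \sum_(i < size w0) (nth false w0 j && ~~ nth false w0 i) *
     f (lvl w0 i) (i %% C.+1) (lvl w0 j) (j %% C.+1))%N.
Proof.
move=> sz st bw0.
have e w' : (\sum_(j < size w') \sum_(i < size w') (nth false w' j && ~~ nth false w' i) *
     f (lvl w' i) (i %% C.+1) (lvl w' j) (j %% C.+1) =
  \sum_(j < size w') (nth false w' j == true) *
   \sum_(i < size w') (nth false w' i == false) *
     f (lvl w' i) (i %% C.+1) (lvl w' j) (j %% C.+1))%N.
  apply: eq_bigr => j _; rewrite big_distrr; apply: eq_bigr => i _ /=.
  by case: (nth _ _ j); case: (nth _ _ i); rewrite ?mul0n ?mul1n ?muln0.
rewrite !e.
rewrite (same_tour_sum true (fun l k => \sum_(i < size w) (nth false w i == false) *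
     f (lvl w i) (i %% C.+1) l k)%N sz st bw0).
apply: eq_bigr => j _; congr (_ * _)%N.
exact: (same_tour_sum false (fun l k => f l k (lvl w0 j) (j %% C.+1)%N) sz st bw0).
Qed.

Lemma same_tour_equidistributed (F : fieldType) (t : F) N (w0 : N.-tuple bool) :
  (forall k, qint t k.+1 != 0) -> t != 0 -> bounded w0 ->
  \sum_(w : N.-tuple bool | same_tour w0 w) t ^+ exit_stat w =
  \sum_(w : N.-tuple bool | same_tour w0 w) t ^+ entry_stat w.
Proof.
move=> tq t0 bw0; have [c0 level0 levelN ub0] := bw0.
have posN : pos al be o w0 N = o.
  have := @pos_bounded w0 N bw0; rewrite size_tuple => -> //.
  rewrite size_tuple in c0 levelN.
  by apply/eqP; rewrite levelN vertex_eq // eqxx mod0n -/(dvdn _ _).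
pose e := cnt al be false o w0; pose d := cnt al be true o w0.
have bal : balanced al be o e d o.
  by have := balanced_walk al be o w0; rewrite size_tuple posN.
have bnd (w : N.-tuple bool) : same_tour w0 w -> bounded w.
  by move=> st; apply: (same_tour_bounded _ st bw0); rewrite !size_tuple.
have visit l x : (0 < cnt al be l o w0 x)%N ->
    exists2 k, (k <= L)%N & exists j, x = vertex K C k j.
  move=> /cnt_gt0P[j jw [_ <-]]; exists (lvl w0 j); first by apply: ub0; exact: ltnW.
  by exists j; rewrite pos_bounded // ltnW.
have far l x : (forall k, (k <= L)%N -> forall j, x <> vertex K C k j) ->
    cnt al be l o w0 x = 0%N.
  by move=> nx; apply/eqP; rewrite -leqn0 leqNgt; apply/negP => /visit[k kL [j /nx]]; apply.
have := exit_entry_equidistributed tq t0 (G := potential be e T) posN.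
rewrite -/e -/d => eq_ee.
transitivity (\sum_(w : N.-tuple bool | has_cnt al be e d o w) t ^+ exit_inv al be o w).
  by apply: eq_bigr => w st; rewrite exit_invE; last exact: bnd st.
rewrite eq_ee; last 2 first.
(* After an east step the level is at most [L + s]; [T] south steps bring it below 0, and [K] is
   large enough that it does not wrap into the range from 0 to [L]. *)
- have Tr : (T <= r * T)%N by exact: leq_pmull.
  move=> x /visit[k kL [j ->]]; apply: potential_al => //; apply: far => k' k'L j'.
  rewrite torus_south_mul addrA => /(canRL (subrK _))/eqP; rewrite !vertexD vertex_eq; lia.
- have Tr : (T.+1 <= r * T.+1)%N by exact: leq_pmull.
  move=> x /visit[k kL [j ->]]; apply: potential_be => //; apply: far => k' k'L j'.
  rewrite torus_south_mul addrA => /(canRL (subrK _))/eqP; rewrite !vertexD vertex_eq; lia.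
by apply: eq_bigr => w st; rewrite entry_invE; last exact: bnd st.
Qed.
End Tours.

Local Close Scope ring_scope.

(** * Crossings of a path with its translates *)

Lemma easts_souths w j : j <= size w -> easts w j + souths w 0 = j + souths w j.
Proof.
move=> jw; rewrite /easts /souths drop0 -[in count id w](cat_take_drop j w) count_cat.
by have := count_id_negb (take j w); rewrite size_takel //; lia.
Qed.

Lemma big_lt_widen N (F : nat -> nat -> nat) :
  \sum_(j < N) \sum_(i < N) (i < j) * F i j = \sum_(j < N) \sum_(i < j) F i j.
Proof.
apply: eq_bigr => j _; rewrite (big_ord_widen N (F^~ j)) 1?ltnW // [RHS]big_mkcond.
by apply: eq_bigr => i _; case: ltnP; rewrite ?mul1n.
Qed.

Section Crossings.
Variables (s r C L : nat).
Hypotheses (s_gt0 : (0 < s)%N) (r_gt0 : (0 < r)%N).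
Notation lvl := (level s r).
Notation bounded := (bounded s r C L).
Notation same_tour := (same_tour s r C L).

(** Eliminating [souths] shows that the level modulo [r + s] depends only on the time. *)
Lemma level_easts w j : j <= size w ->
  lvl w j + r * j = r * souths w 0 + (r + s) * easts w j.
Proof. by move=> jw; have := easts_souths jw; rewrite /level; nia. Qed.

(** The gaps strictly reversed by an east step at [i] together with a south step at [j], which
    change the gap by [r + s]. *)
Definition near_below w i j :=
  (lvl w i < lvl w j < lvl w i + (r + s)) && (i == j %[mod C.+1]).

Definition mid_stat w := \sum_(j < size w) \sum_(i < size w)
  [&& i < j, ~~ nth false w i, nth false w j & near_below w i j].

Definition rev_mid_stat w := \sum_(j < size w) \sum_(i < size w)
  [&& i < j, nth false w i, ~~ nth false w j & near_below w j i].

(** Compares the path with its translate by [j - i] steps. The divisibility condition discards the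
    translates whose gaps are multiples of [r + s]: these have no strict crossing. *)
Definition above w i j :=
  [&& lvl w i < lvl w j, ~~ (r + s %| r * (j - i)) & i == j %[mod C.+1]].

(** One step on both paths changes the gap by [r + s], by its opposite or not at all; the order is
    reversed exactly at the counted pairs. *)
Lemma crossing w i j : i < j -> j < size w ->
  [&& nth false w i, ~~ nth false w j & near_below w j i] + above w i j =
  [&& ~~ nth false w i, nth false w j & near_below w i j] + above w i.+1 j.+1.
Proof.
move=> ij jw; have iw := ltn_trans ij jw.
rewrite /near_below /above subSS [j == i %[mod _]]eq_sym.
have -> : (i.+1 == j.+1 %[mod C.+1]) = (i == j %[mod C.+1]).
  by rewrite -[i.+1]addn1 -[j.+1]addn1 eqn_modDr.
case: (i == j %[mod _]); last by rewrite !andbF.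
rewrite !andbT; have li := level_easts (ltnW iw); have lj := level_easts (ltnW jw).
have eji : r * j = r * i + r * (j - i) by rewrite -mulnDr; congr (_ * _); lia.
have Li := levelS s r iw; have Lj := levelS s r jw.
move: (nth false w i) (nth false w j) Li Lj => bi bj.
move: (lvl w i.+1) (lvl w j.+1) => A' B'.
move: (lvl w i) (lvl w j) (easts w i) (easts w j) li lj => A B x y.
move: (r * (j - i)) eji => X; move: (r * j) (r * i) (r * souths w 0) => rj ri c0.
move=> -> li lj; have {li lj} eAB : B + X + (r + s) * x = A + (r + s) * y by lia.
(* By [level_easts] the gap is congruent to minus [r * (j - i)] modulo [r + s]. In the first case it
   is a multiple of [r + s], never strictly in between; in the second it is never 0 nor [r + s] in
   absolute value. *)
case: dvdnP => [[q eq]|nq] Li Lj.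
  have {}eAB : B + (r + s) * (q + x) = A + (r + s) * y by rewrite eq in eAB; lia.
  have nlt a b : (a < b) = ((r + s) * a < (r + s) * b).
    by rewrite ltn_pmul2l //; lia.
  have -> : (B < A < B + (r + s)) = false.
    apply/negP => AB; have : y < q + x by move: (nlt (q + x) y) (nlt y (q + x)); lia.
    have : q + x < y.+1 by move: (nlt (q + x) y.+1); rewrite mulnS; lia.
    lia.
  have -> : (A < B < A + (r + s)) = false.
    apply/negP => AB; have : q + x < y by move: (nlt (q + x) y); lia.
    have : y < (q + x).+1 by move: (nlt y (q + x).+1); rewrite mulnS; lia.
    lia.
  by rewrite !andbF.
have nAB : B <> A.
  by move=> e; apply: nq; exists (y - x); rewrite mulnBl ![_ * (r + s)]mulnC; lia.
have nABm : B <> A + (r + s).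
  by move=> e; apply: nq; exists (y - x.+1); rewrite mulnBl ![_ * (r + s)]mulnC mulnS; lia.
have nBAm : A <> B + (r + s).
  by move=> e; apply: nq; exists (y.+1 - x); rewrite mulnBl ![_ * (r + s)]mulnC mulnS; lia.
by case: bi bj Li Lj => [] [] /=; lia.
Qed.

(** The last level [L] is maximal, and equality with it would contradict the divisibility
    condition. *)
Lemma above_end w i : bounded w -> i < size w ->
  above w i (size w) =
  ~~ (r + s %| r * (size w - i)) && (i == size w %[mod C.+1]).
Proof.
move=> [_ _ levelN ub] iw; rewrite /above levelN.
case: dvdnP => [_|nq]; first by rewrite andbF.
have := ub _ (ltnW iw); rewrite leq_eqVlt => /predU1P[e|->//].
case: nq; have := level_easts (ltnW iw); have := level_easts (leqnn (size w)).
rewrite e levelN => eN ei; exists (easts w (size w) - easts w i).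
by rewrite mulnBr mulnBl ![_ * (r + s)]mulnC; lia.
Qed.

(** Summing [crossing] over all translates telescopes. No translate starts above the path, whose
    first level is maximal, and by [above_end] the number of those ending above depends only on the
    length. *)
Lemma rev_mid_statE w : bounded w -> rev_mid_stat w = mid_stat w +
  \sum_(i < size w)
     (~~ (r + s %| r * (size w - i)) && (i == size w %[mod C.+1])).
Proof.
move=> bw; set N := size w.
have -> : \sum_(i < N) (~~ (r + s %| r * (N - i)) && (i == N %[mod C.+1])) =
  \sum_(i < N) above w i N by apply: eq_bigr => i _; rewrite above_end.
pose Tab j := \sum_(i < j) above w i j.
have e_rev : rev_mid_stat w = \sum_(j < N) \sum_(i < j)
    [&& nth false w i, ~~ nth false w j & near_below w j i].
  rewrite -(big_lt_widen N (fun i j =>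
    [&& nth false w i, ~~ nth false w j & near_below w j i] : nat)).
  apply: eq_bigr => j _; apply: eq_bigr => i _.
  by case: (i < j); rewrite ?mul1n.
have e_mid : mid_stat w = \sum_(j < N) \sum_(i < j)
    [&& ~~ nth false w i, nth false w j & near_below w i j].
  rewrite -(big_lt_widen N (fun i j =>
    [&& ~~ nth false w i, nth false w j & near_below w i j] : nat)).
  apply: eq_bigr => j _; apply: eq_bigr => i _.
  by case: (i < j); rewrite ?mul1n.
have TabS j : j < N -> Tab j.+1 = \sum_(i < j) above w i.+1 j.+1.
  move=> jN; rewrite /Tab big_ord_recl /= {1}/above.
  case: bw => _ -> _ /(_ j.+1 jN); rewrite leqNgt => /negbTE->.
  by [].
have sum_eq : rev_mid_stat w + \sum_(j < N) Tab j =
    mid_stat w + \sum_(j < N) Tab j.+1.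
  rewrite e_rev e_mid -!big_split; apply: eq_bigr => j _ /=.
  rewrite TabS // -!big_split; apply: eq_bigr => i _ /=.
  exact: crossing.
apply: (@addIn (\sum_(j < N) Tab j)); rewrite sum_eq -addnA; congr (_ + _).
have -> : \sum_(i < N) above w i N = Tab N by [].
have T0 : Tab 0 = 0 by rewrite /Tab big_ord0.
have e1 : \sum_(j < N.+1) Tab j = Tab 0 + \sum_(j < N) Tab j.+1.
  by rewrite big_ord_recl.
have e2 : \sum_(j < N.+1) Tab j = \sum_(j < N) Tab j + Tab N.
  by rewrite big_ord_recr.
lia.
Qed.

(** The sum of [mid_stat] and [rev_mid_stat] no longer involves the order of the steps, so
    [same_tour_sum2] fixes it; [rev_mid_statE] fixes their difference. *)
Lemma same_tour_mid w0 w : size w = size w0 -> same_tour w0 w -> bounded w0 ->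
  mid_stat w = mid_stat w0.
Proof.
move=> sz st bw0; have bw := same_tour_bounded s_gt0 r_gt0 sz st bw0.
pose f (a p b q : nat) : nat := (a < b < a + (r + s)) && (p == q).
have total w' : \sum_(j < size w') \sum_(i < size w')
    (nth false w' j && ~~ nth false w' i) *
    f (lvl w' i) (i %% C.+1) (lvl w' j) (j %% C.+1) = mid_stat w' + rev_mid_stat w'.
  rewrite /rev_mid_stat [X in _ + X]exchange_big -big_split; apply: eq_bigr => j _ /=.
  rewrite -big_split; apply: eq_bigr => i _ /=; rewrite /f /near_below.
  case: (ltngtP i j) => [ij|ji|/val_inj->].
  - by rewrite addn0; case: (nth _ _ i); case: (nth _ _ j); rewrite ?mul0n ?mul1n.
  - by case: (nth _ _ i); case: (nth _ _ j); rewrite ?mul0n ?mul1n.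
  - by case: (nth _ _ j).
have := same_tour_sum2 s_gt0 r_gt0 f sz st bw0.
by rewrite !total !rev_mid_statE // sz; lia.
Qed.
End Crossings.

(** * Boxes as pairs of steps *)

Lemma mem_boxes la b : (b \in boxes la) = (b.2 < nth 0 la b.1).
Proof.
apply/allpairsPdep/idP => [[i [j []]]|lt]; first by rewrite !mem_iota => _ /= lt ->.
exists b.1, b.2; rewrite !mem_iota /= -surjective_pairing; split=> //.
by case: (ltnP b.1 (size la)) => // /(nth_default 0) e; rewrite e in lt.
Qed.

Lemma count_boxes (p : pred (nat * nat)) la :
  count p (boxes la) = \sum_(i < size la) \sum_(j < nth 0 la i) p (val i, val j).
Proof.
have iotaE n : iota 0 n = index_iota 0 n by rewrite /index_iota subn0.
rewrite /boxes count_flatten -map_comp sumnE big_map iotaE big_mkord.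
apply: eq_bigr => i _ /=; rewrite count_map -sum1_count iotaE.
by rewrite big_mkcond big_mkord; apply: eq_bigr => j _ /=; case: (p _).
Qed.

Lemma armE la y x : arm la (y, x) = nth 0 la y - x.+1.
Proof.
rewrite /arm count_boxes /=.
have sum_gt k : \sum_(j < k) (x < j) = k - x.+1.
  by elim: k => [|k IHk]; rewrite ?big_ord0 // big_ord_recr IHk /=; lia.
case: (ltnP y (size la)) => [yla|ley].
  rewrite (bigD1 (Ordinal yla)) //= eqxx sum_gt big1 ?addn0 // => i.
  rewrite -val_eqE /= => /negbTE->.
  by rewrite big1.
rewrite nth_default // big1 // => i _; rewrite big1 // => j _.
by have := ltn_ord i; case: eqP => //; lia.
Qed.

Lemma legE la y x : leg la (y, x) = count (fun k => x < k) (drop y.+1 la).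
Proof.
rewrite /leg count_boxes /=.
elim: la y => [|k la IHla] y; first by rewrite big_ord0.
rewrite big_ord_recl /= big1 ?add0n; last by move=> j _; rewrite andbF.
case: y => [|y]; last by rewrite -IHla.
rewrite drop0 -sum1_count [RHS]big_mkcond (big_nth 0) big_mkord; apply: eq_bigr => i _ /=.
have sum_eq n : \sum_(j < n) (j == x :> nat) = (x < n).
  by elim: n => [|n IHn]; rewrite ?big_ord0 // big_ord_recr IHn /=; lia.
under eq_bigr => j _ do rewrite andbT.
by rewrite sum_eq; case: (x < _).
Qed.

Definition box_stat (g : nat -> nat -> bool) la :=
  count (fun b => g (arm la b) (leg la b)) (boxes la).

Lemma box_stat_cons g k la : box_stat g (k :: la) =
  \sum_(x < k) g (k - x.+1) (count (fun k' => x < k') la) + box_stat g la.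
Proof.
rewrite /box_stat !count_boxes /= big_ord_recl; congr (_ + _).
  by apply: eq_bigr => x _; rewrite armE legE /= drop0.
by apply: eq_bigr => i _; apply: eq_bigr => x _ /=; rewrite !armE !legE.
Qed.

(** Reversed because the word starts at the top row. Each south step gives a row, so zero rows are
    kept. *)
Definition rows w := rev [seq easts w j | j <- iota 0 (size w) & nth false w j].

Lemma easts_rcons w l j : j <= size w -> easts (rcons w l) j = easts w j.
Proof. by move=> jw; rewrite /easts -cats1 takel_cat. Qed.

Lemma souths_rcons w l j : j <= size w -> souths (rcons w l) j = souths w j + l.
Proof.
by move=> jw; rewrite /souths drop_rcons // -cats1 count_cat /= addn0.
Qed.

Lemma rows_rcons w l :
  rows (rcons w l) = if l then count negb w :: rows w else rows w.
Proof.
rewrite /rows size_rcons -addn1 iotaD filter_cat map_cat rev_cat add0n /=.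
have -> : [seq j <- iota 0 (size w) | nth false (rcons w l) j] =
          [seq j <- iota 0 (size w) | nth false w j].
  by apply: eq_in_filter => j; rewrite mem_iota /= => jw; rewrite nth_rcons jw.
have -> : [seq easts (rcons w l) j | j <- iota 0 (size w) & nth false w j] =
          [seq easts w j | j <- iota 0 (size w) & nth false w j].
  apply/eq_in_map => j; rewrite mem_filter mem_iota => /andP[_ jw].
  by rewrite easts_rcons // ltnW.
by rewrite nth_rcons ltnn eqxx; case: l; rewrite //= easts_rcons // easts_size.
Qed.

Lemma easts_le w j : easts w j <= count negb w.
Proof. by rewrite /easts -[X in _ <= count _ X](cat_take_drop j) count_cat leq_addr. Qed.

Lemma rows_le w : all (fun k => k <= count negb w) (rows w).
Proof. by apply/allP => k; rewrite mem_rev => /mapP[j _ ->]; exact: easts_le. Qed.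

Lemma size_rows w : size (rows w) = count id w.
Proof.
elim/last_ind: w => // w l IHw; rewrite rows_rcons -cats1 count_cat /= addn0 -IHw.
by case: l; rewrite /= ?addn1 ?addn0.
Qed.

Lemma rows_sorted w : sorted geq (rows w).
Proof.
elim/last_ind: w => // w [] IHw; rewrite rows_rcons //=.
rewrite path_sortedE //; last by move=> x y z /=; lia.
by rewrite IHw andbT; exact: rows_le.
Qed.

Lemma sumn_rows w : sumn (rows w) = \sum_(j < size w) nth false w j * easts w j.
Proof.
elim/last_ind: w => [|w l IHw]; first by rewrite big_ord0.
rewrite rows_rcons size_rcons big_ord_recr /= nth_rcons ltnn eqxx.
rewrite (eq_bigr (fun j : 'I_(size w) => nth false w j * easts w j)); last first.
  by move=> j _; rewrite nth_rcons ltn_ord easts_rcons // ltnW.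
rewrite -IHw easts_rcons // easts_size.
by case: l; rewrite /= ?mul1n ?addn0 // addnC.
Qed.

Lemma sum_easts w (F : nat -> nat) :
  \sum_(x < count negb w) F x = \sum_(i < size w) ~~ nth false w i * F (easts w i).
Proof.
elim/last_ind: w => [|w l IHw]; first by rewrite !big_ord0.
rewrite size_rcons big_ord_recr /= nth_rcons ltnn eqxx.
rewrite (eq_bigr (fun i : 'I_(size w) => ~~ nth false w i * F (easts w i))); last first.
  by move=> j _; rewrite nth_rcons ltn_ord easts_rcons // ltnW.
rewrite -IHw easts_rcons // easts_size -cats1 count_cat /= addn0.
by case: l; rewrite /= ?addn0 // addn1 big_ord_recr /= mul1n.
Qed.

Lemma count_rows_gt w i : i < size w -> ~~ nth false w i ->
  count (fun k => easts w i < k) (rows w) = souths w i.+1.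
Proof.
elim/last_ind: w => // w l IHw; rewrite size_rcons ltnS leq_eqVlt.
case: eqP => [->|_] /= iw; rewrite nth_rcons ?ltnn ?eqxx ?iw => wi.
  rewrite -[X in souths _ X](size_rcons w l) souths_size rows_rcons (negbTE wi).
  apply/eqP; rewrite -leqn0 leqNgt -has_count; apply/hasPn => k /(allP (rows_le w)).
  by rewrite easts_rcons // easts_size -leqNgt.
rewrite souths_rcons // -IHw // easts_rcons 1?ltnW // rows_rcons.
case: l => /=; rewrite ?addn0 // addnC; congr (_ + _).
by have := easts_le w i.+1; rewrite eastsS // wi addn1 => ->.
Qed.

Definition path_stat (g : nat -> nat -> bool) w :=
  \sum_(j < size w) \sum_(i < size w) [&& i < j, ~~ nth false w i, nth false w j
    & g (easts w j - easts w i.+1) (souths w i.+1 - souths w j)].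

Lemma path_statE g w : path_stat g w = \sum_(j < size w) \sum_(i < j)
  [&& ~~ nth false w i, nth false w j
    & g (easts w j - easts w i.+1) (souths w i.+1 - souths w j)].
Proof.
rewrite -(big_lt_widen (size w) (fun i j => [&& ~~ nth false w i, nth false w j
    & g (easts w j - easts w i.+1) (souths w i.+1 - souths w j)] : nat)).
by apply: eq_bigr => j _; apply: eq_bigr => i _; case: (i < j); rewrite ?mul1n.
Qed.

(** Induction on the last step: a south step adds a bottom row, whose boxes are its pairs with the
    earlier east steps; an east step adds no box. *)
Lemma box_stat_rows g w : box_stat g (rows w) = path_stat g w.
Proof.
elim/last_ind: w => [|w l IHw]; first by rewrite /path_stat big_ord0.
rewrite path_statE size_rcons big_ord_recr /=.
have -> : \sum_(j < size w) \sum_(i < j) [&& ~~ nth false (rcons w l) i,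
      nth false (rcons w l) j
    & g (easts (rcons w l) j - easts (rcons w l) i.+1)
        (souths (rcons w l) i.+1 - souths (rcons w l) j)] = path_stat g w.
  rewrite path_statE; apply: eq_bigr => j _; apply: eq_bigr => i _.
  have ji := ltn_ord i; have jw := ltn_ord j.
  rewrite !nth_rcons jw (ltn_trans ji jw).
  by rewrite !easts_rcons ?souths_rcons ?subnDr //; lia.
rewrite -IHw rows_rcons nth_rcons ltnn eqxx.
case: l; last by rewrite big1 ?addn0 // => i _; rewrite andbF.
rewrite box_stat_cons addnC; congr (_ + _).
rewrite (sum_easts w (fun x => g (count negb w - x.+1) (count (fun k => x < k) (rows w)))).
apply: eq_bigr => i _; have iw := ltn_ord i; rewrite nth_rcons iw.
case wi: (nth false w i); rewrite ?mul0n //= mul1n.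
rewrite count_rows_gt ?wi // !easts_rcons // eastsS // wi addn1 easts_size.
by rewrite !souths_rcons // souths_size addnK.
Qed.

Lemma easts_over w j : size w <= j -> easts w j = count negb w.
Proof. by move=> jw; rewrite /easts take_oversize. Qed.

(* The corner of the path on the diagonal of a box tells whether the box lies
   below the path. *)
Lemma box_diag w y x : y < count id w ->
  (x < nth 0 (rows w) y) = (x < easts w (count id w + x - y)).
Proof.
elim/last_ind: w y => // w l IHw y.
rewrite rows_rcons -cats1 count_cat /= addn0 cats1.
have Nw := count_id_negb w.
case: l => /= [|yV]; last first.
  rewrite addn0 in yV *; rewrite IHw //.
  case: (leqP (count id w + x - y) (size w)) => [jw|wj]; first by rewrite easts_rcons.
  rewrite !easts_over ?size_rcons //; last by exact: ltnW.
  by rewrite -cats1 count_cat /=; lia.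
rewrite addn1; set j := (_ + x - y).
have -> : easts (rcons w true) j = easts w j.
  case: (leqP j (size w)) => [jw|wj]; first by rewrite easts_rcons.
  by rewrite !easts_over ?size_rcons // 1?ltnW // -cats1 count_cat addn0.
case: y @j => [|y] j yV /=; last by rewrite IHw.
case: (leqP j (size w)) => [jw|wj]; last by rewrite easts_over // ltnW.
have e := easts_souths jw; rewrite souths0 in e.
by apply/idP/idP => _; rewrite {}/j in jw e *; lia.
Qed.

Lemma rows_cat_false w k : rows (w ++ nseq k false) = rows w.
Proof.
elim: k w => [|k IHk] w; first by rewrite cats0.
by rewrite -cat_rcons IHk rows_rcons.
Qed.

(** The bottom row [k] is read last: its south step comes after [k] east steps and before the
    remaining [U - k]. *)
Fixpoint path_of_rows (r : seq nat) (U : nat) : seq bool :=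
  if r is k :: r' then path_of_rows r' k ++ true :: nseq (U - k) false else nseq U false.

Lemma path_of_rowsP r U : path geq U r ->
  [/\ rows (path_of_rows r U) = r, count negb (path_of_rows r U) = U
    & count id (path_of_rows r U) = size r].
Proof.
elim: r U => [|k r IHr] U /=.
  move=> _; rewrite -[nseq _ _]cat0s rows_cat_false !count_nseq /=.
  by rewrite mul1n mul0n.
move=> /andP[kU /IHr[e1 e2 e3]].
rewrite -cat_rcons rows_cat_false rows_rcons e1 e2; split=> //.
  by rewrite count_cat -cats1 count_cat e2 count_nseq /= mul1n !addn0 subnKC.
by rewrite count_cat -cats1 count_cat e3 count_nseq /= mul0n addn0 addn1.
Qed.

Lemma rowsK w : path_of_rows (rows w) (count negb w) = w.
Proof.
elim/last_ind: w => // w l IHw; rewrite rows_rcons -cats1 count_cat /= addn0.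
case: l => /=; first by rewrite addn0 subnn IHw.
have eU : nseq 1 false = [:: false] by [].
move: (rows_le w) IHw; case: (rows w) => [_ /= {2}<-|k r /= /andP[kU _] {2}<-].
  by rewrite -eU -nseqD.
by rewrite -catA -eU -cat1s -[in RHS]cat1s -catA -nseqD addnBAC.
Qed.

(** * Partitions inside a rectangle and their words *)

Section Fits.
Variables (V U : nat).

Definition fits la := [&& is_partition la, size la <= V & all (fun k => k <= U) la].

(** With zero rows added, all partitions in the rectangle have words with the same numbers of
    steps. *)
Definition pad la := la ++ nseq (V - size la) 0.

Definition word la := path_of_rows (pad la) U.

Definition pos_parts (r : seq nat) := [seq k <- r | 0 < k].

Lemma path_pad la : fits la -> path geq U (pad la).
Proof.
move=> /and3P[/andP[srt _] _ leU].
rewrite path_sortedE; last by move=> x y z /=; lia.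
rewrite all_cat leU /=; apply/andP; split.
  by apply/allP => k /nseqP[-> _].
rewrite /pad; case: la srt {leU} => [_|k la /= srt].
  by elim: (_ - _) => [|[|m]].
rewrite cat_path srt /=.
elim: (_ - _) (last k la) => //= m IHm x; rewrite leq0n; exact: IHm.
Qed.

Lemma rows_word la : fits la -> rows (word la) = pad la.
Proof. by move/path_pad/path_of_rowsP => []. Qed.

Lemma count_word la : fits la -> count id (word la) = V.
Proof.
move=> fl; have [_ _ ->] := path_of_rowsP (path_pad fl).
by case/and3P: fl => _ sV _; rewrite size_cat size_nseq subnKC.
Qed.

Lemma countN_word la : fits la -> count negb (word la) = U.
Proof. by move=> fl; have [_ -> _] := path_of_rowsP (path_pad fl). Qed.

Lemma size_word la : fits la -> size (word la) = V + U.
Proof. by move=> fl; rewrite -count_id_negb count_word // countN_word. Qed.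

Lemma nth_pad la y : nth 0 (pad la) y = nth 0 la y.
Proof.
rewrite nth_cat; case: ltnP => // le; rewrite nth_nseq [RHS]nth_default //.
by case: ifP.
Qed.

Lemma mem_boxes_word la y x : fits la -> y < V ->
  ((y, x) \in boxes la) = (x < easts (word la) (V + x - y)).
Proof.
move=> fl yV; rewrite mem_boxes /= -nth_pad -rows_word //.
by rewrite box_diag count_word.
Qed.

Lemma fits_lt la b : fits la -> b \in boxes la -> b.1 < V /\ b.2 < U.
Proof.
move=> /and3P[_ sV leU]; rewrite mem_boxes => bla.
have b1 : b.1 < size la.
  by case: ltnP => // /(nth_default 0) e; rewrite e in bla.
split; first exact: leq_trans sV.
by apply: leq_trans bla _; apply: (allP leU); rewrite mem_nth.
Qed.

Lemma pos_parts_partition r : sorted geq r -> is_partition (pos_parts r).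
Proof.
move=> srt; rewrite /is_partition sorted_filter //=; last by move=> x y z /=; lia.
by rewrite mem_filter.
Qed.

Lemma pos_parts_fits w : count id w = V -> count negb w = U -> fits (pos_parts (rows w)).
Proof.
move=> wV wU; rewrite /fits pos_parts_partition ?rows_sorted //=; apply/andP; split.
  by rewrite size_filter (leq_trans (count_size _ _)) // size_rows wV.
by apply/allP => k; rewrite mem_filter -wU => /andP[_ /(allP (rows_le w))].
Qed.

Lemma pad_pos_parts r : sorted geq r -> size r = V -> pad (pos_parts r) = r.
Proof.
move=> srt sV; rewrite /pad -{}sV.
elim: r srt => //= k r IHr srt; case: (posnP k) srt => [->|k0] srt /=.
  have r0 : r = nseq (size r) 0.
    apply/all_pred1P/allP => x xr /=; rewrite -leqn0.
    by move: srt; rewrite path_sortedE => [/andP[/allP/(_ x xr)]|x' y z /=]; last by lia.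
  have -> : pos_parts r = [::] by rewrite /pos_parts r0 filter_nseq.
  by rewrite subn0 /= -r0.
by rewrite subSS IHr // (path_sorted srt).
Qed.

Lemma word_pos_parts w : count id w = V -> count negb w = U -> word (pos_parts (rows w)) = w.
Proof.
move=> wV wU; rewrite /word pad_pos_parts ?rows_sorted ?size_rows // -wU.
exact: rowsK.
Qed.

Lemma pos_parts_word la : fits la -> pos_parts (rows (word la)) = la.
Proof.
move=> fl; rewrite rows_word // /pos_parts filter_cat filter_nseq /= cats0.
case/and3P: fl => /andP[_ la0] _ _; apply/all_filterP/allP => k kla.
by rewrite lt0n; apply: contraNneq la0 => <-.
Qed.

Lemma box_stat_pad g la : box_stat g (pad la) = box_stat g la.
Proof.
rewrite /pad; elim: (V - _) => [|k IHk]; first by rewrite cats0.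
rewrite -[in LHS]addn1 nseqD catA -{}IHk; move: (la ++ _) => r.
elim: r => [|k' r IHr] /=; first by rewrite box_stat_cons big_ord0.
rewrite !box_stat_cons IHr; congr (_ + _); apply: eq_bigr => x _.
by rewrite count_cat /= !addn0.
Qed.

Lemma sumn_pad la : sumn (pad la) = sumn la.
Proof. by rewrite sumn_cat sumn_nseq mul0n addn0. Qed.

Lemma sum_fits n la : is_partition la -> sumn la <= n -> n <= V -> n <= U -> fits la.
Proof.
move=> pla sla nV nU; have /andP[_ la0] := pla; apply/and3P; split => //.
  by apply: leq_trans nV; apply: leq_trans sla; exact: size_le_sumn.
by apply/allP => k /le_sumn kla; apply: leq_trans nU; apply: leq_trans sla.
Qed.
End Fits.

(** * Rimhooks and cores *)

Lemma easts_le_id w j : easts w j <= j.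
Proof.
by rewrite (leq_trans (count_size _ _)) // size_take; case: ltnP => // /ltnW.
Qed.

Lemma boxes_le mu b b' : is_partition mu -> b \in boxes mu ->
  b'.1 <= b.1 -> b'.2 <= b.2 -> b' \in boxes mu.
Proof.
rewrite !mem_boxes => /andP[srt _] bmu le1 le2; apply: (leq_ltn_trans le2).
apply: (leq_trans bmu _).
have b1 : b.1 < size mu.
  by case: (ltnP b.1 (size mu)) bmu => // /(nth_default 0)->.
have geqtr : transitive geq by move=> x y z /=; lia.
have := sorted_leq_nth geqtr (leqnn : reflexive geq) 0 srt.
by apply=> //; rewrite inE; apply: leq_ltn_trans b1.
Qed.

Section Rimhooks.
Implicit Types b : nat * nat.
Variables (V U c : nat).
Notation fits := (fits V U).
Notation word := (word V U).

(* Shifted so as to be positive: the boxes of content [j] lie on the diagonal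
   that the path crosses after [j] steps. *)
Definition content (b : nat * nat) := V + b.2 - b.1.

Lemma content_adjacent b b' : b.1 <= V -> b'.1 <= V -> adjacent b b' ->
  content b' = (content b).+1 \/ content b = (content b').+1.
Proof.
rewrite /content /adjacent => bV b'V.
by case/orP => /andP[/eqP e /orP[/eqP e'|/eqP e']]; lia.
Qed.

(** A discrete intermediate value theorem, as contents of adjacent boxes differ by one. *)
Lemma content_path b p k : all (fun b' => b'.1 <= V) (b :: p) ->
  path adjacent b p -> content b <= k <= content (last b p) ->
  exists2 b', b' \in b :: p & content b' = k.
Proof.
elim: p b => [|b1 p IHp] b /= /andP[bV pV].
  by move=> _ k_eq; exists b; [rewrite mem_head | lia].
move=> /andP[adj pth] kk.
have b1V : b1.1 <= V by case/andP: pV.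
have [->|kb] := eqVneq k (content b); first by exists b; rewrite ?mem_head.
have [|b' b'p <-] := IHp b1 pV pth.
  by have := content_adjacent bV b1V adj; move: kb; lia.
by exists b' => //; rewrite in_cons b'p orbT.
Qed.

Section Removal.
Variables (la nu : seq nat) (R : seq (nat * nat)).
Hypotheses (fla : fits la) (rem : rimhook_removal c la R nu).

Lemma removal_fits : fits nu.
Proof.
have [_ _ _ _ [pnu bnu]] := rem; apply/and3P; split=> //.
  rewrite leqNgt; apply/negP => Vnu.
  have : (V, 0) \in boxes nu.
    rewrite mem_boxes /= lt0n; case/andP: pnu => _ nu0.
    by apply: contraNneq nu0 => <-; rewrite mem_nth.
  by rewrite bnu mem_filter => /andP[_ /(fits_lt fla)[]]; rewrite ltnn.
apply/allP => k /(nthP 0)[y ynu yk]; rewrite leqNgt; apply/negP => Uk.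
have : (y, U) \in boxes nu by rewrite mem_boxes /= yk.
by rewrite bnu mem_filter => /andP[_ /(fits_lt fla)[_]]; rewrite ltnn.
Qed.

Lemma removal_lt b : b \in R -> b.1 < V /\ b.2 < U.
Proof. by have [_ sub _ _ _] := rem; move=> /sub/(fits_lt fla). Qed.

Lemma removal_mem b : (b \in boxes la) = (b \in boxes nu) || (b \in R).
Proof.
have [_ sub _ _ [_ ->]] := rem; rewrite mem_filter.
by case bR: (b \in R); rewrite /= ?orbF // (sub _ bR).
Qed.

Lemma removal_disj b : b \in R -> b \notin boxes nu.
Proof. by have [_ _ _ _ [_ ->]] := rem; rewrite mem_filter => ->. Qed.

(** Two boxes of [R] on one diagonal would span a rectangle contained in [R], hence a 2 by 2
    square. *)
Lemma removal_diag b b' : b \in R -> b' \in R -> content b = content b' -> b = b'.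
Proof.
have [_ _ _ no22 [pnu _]] := rem.
have main (b1 b2 : nat * nat) : b1 \in R -> b2 \in R -> content b1 = content b2 ->
    b1.1 < b2.1 -> False.
  move=> b1R b2R; have [b1V _] := removal_lt b1R; have [b2V _] := removal_lt b2R.
  rewrite /content => e lt12.
  have pla : is_partition la by case/and3P: fla.
  have b2la : b2 \in boxes la by rewrite removal_mem b2R orbT.
  (* Such a box lies in [la] because [b2] does, and if it were in [nu] then so would be [b1]. *)
  have inR y x : b1.1 <= y <= b2.1 -> b1.2 <= x <= b2.2 -> (y, x) \in R.
    move=> /andP[y1 y2] /andP[x1 x2].
    have := boxes_le pla b2la (b' := (y, x)) y2 x2; rewrite removal_mem => /orP[|//] yx.
    by have := removal_disj b1R; rewrite (boxes_le pnu yx).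
  by have := no22 b1.1 b1.2; rewrite !inR //; lia.
move=> bR b'R e; have [bV _] := removal_lt bR; have [b'V _] := removal_lt b'R.
case: (ltngtP b.1 b'.1) => [lt|lt|e1].
- by case: (main b b').
- by case: (main b' b).
move: e; rewrite /content e1 => e; rewrite [b]surjective_pairing [b']surjective_pairing e1.
by congr (_, _); lia.
Qed.

(** Contents that differ by a positive multiple of [c] would, by connectedness, force [c.+1]
    distinct contents on [c] boxes. *)
Lemma removal_residue b b' : b \in R -> b' \in R ->
  content b = content b' %[mod c] -> b = b'.
Proof.
have [[uR sR] sub conn _ _] := rem.
have main (b1 b2 : nat * nat) : b1 \in R -> b2 \in R ->
    content b1 = content b2 %[mod c] ->
    content b1 <= content b2 -> content b1 = content b2.
  move=> b1R b2R e le12; have : c %| content b2 - content b1.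
    by rewrite -eqn_mod_dvd // e.
  case/dvdnP => -[|q] eq; first by lia.
  have [p [pth pR lst]] := conn _ _ b1R b2R.
  have : {subset iota (content b1) c.+1 <= [seq content b | b <- R]}.
    move=> k; rewrite mem_iota => kk.
    have [||b3 b3p <-] := @content_path b1 p k _ pth.
    - rewrite /= ltnW /=; last by case: (removal_lt b1R).
      by apply/allP => b3 /(allP pR)/removal_lt[/ltnW].
    - rewrite lst; move: eq; rewrite mulSn; lia.
    - apply: map_f; move: b3p; rewrite in_cons => /predU1P[->//|].
      exact: (allP pR).
  move=> /(uniq_leq_size (iota_uniq _ _)).
  by rewrite size_iota size_map sR ltnn.
move=> bR b'R e; apply: removal_diag => //.
case: (leqP (content b) (content b')) => [|/ltnW] le; first exact: main.
by symmetry; apply: main.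
Qed.

(** On diagonal [j] a box lies in the partition when its column is less than [easts] at [j], so both
    sides can be compared column by column. *)
Lemma removal_easts j : easts (word la) j =
  easts (word nu) j + count (fun b => content b == j) R.
Proof.
have [[uR _] _ _ _ _] := rem; have fnu := removal_fits.
have sum_ltn n u : \sum_(x < n) (x < u) = minn n u.
  by elim: n => [|n IHn]; rewrite ?big_ord0 ?big_ord_recr ?IHn /=; lia.
have eastsE mu : fits mu -> easts (word mu) j = \sum_(x < U) (x < easts (word mu) j).
  move=> fmu; have := easts_le (word mu) j; rewrite (countN_word fmu) sum_ltn.
  by move/minn_idPr.
have -> : count (fun b => content b == j) R =
    \sum_(x < U) count (fun b => (b.2 == x) && (content b == j)) R.
  have : {subset R <= [pred b | b.2 < U]} by move=> b /removal_lt[].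
  elim: (R) => [|b R' IHR] sub /=; first by rewrite big1.
  rewrite big_split -IHR /=; last by move=> b' b'R; apply: sub; rewrite in_cons b'R orbT.
  congr (_ + _); have b2U : b.2 < U by apply: sub; rewrite mem_head.
  rewrite (bigD1 (Ordinal b2U)) //= eqxx big1 ?addn0 // => x.
  by rewrite -val_eqE eq_sym /= => /negbTE->.
rewrite (eastsE la) // (eastsE nu) // -big_split; apply: eq_bigr => x _ /=.
have [jN|Nj] := leqP j (V + U); last first.
  have over mu : fits mu -> easts (word mu) j = U.
    by move=> fmu; rewrite easts_over ?countN_word // size_word // ltnW.
  rewrite !over // ltn_ord -[LHS]addn0; congr (_ + _); symmetry; apply/eqP.
  rewrite -leqn0 leqNgt -has_count; apply/hasPn => b /removal_lt[b1 b2].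
  by rewrite /content; case: eqP => //=; lia.
have dg mu : fits mu -> easts (word mu) j + V = j + souths (word mu) j.
  by move=> fmu; have := @easts_souths (word mu) j;
  rewrite souths0 count_word // size_word //; apply.
have none : (forall b, b.1 < V -> b.2 = x -> content b <> j) ->
    count (fun b => (b.2 == x) && (content b == j)) R = 0.
  move=> nb; apply/eqP; rewrite -leqn0 leqNgt -has_count; apply/hasPn => b.
  by move=> /removal_lt[bV _]; apply/negP => /andP[/eqP/(nb _ bV) + /eqP].
(* Column [x] meets diagonal [j] within the [V] rows only if [x < j <= V + x]; the other cases
   follow from bounds on [easts]. *)
have [jx|xj] := leqP j x.
  rewrite none ?addn0; last by rewrite /content => b bV bx; lia.
  by have := easts_le_id (word la) j; have := easts_le_id (word nu) j; lia.
have [Vx|xV] := ltnP (V + x) j.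
  rewrite none ?addn0; last by rewrite /content => b bV bx; lia.
  by have := dg _ fla; have := dg _ fnu; lia.
pose b0 : nat * nat := (V + x - j, nat_of_ord x).
have yV : V + x - j < V by lia.
have je : j = V + x - (V + x - j) by lia.
rewrite [in LHS]je [in X in _ = X + _]je -!mem_boxes_word // removal_mem.
have -> : count (fun b => (b.2 == x) && (content b == j)) R = (b0 \in R).
  rewrite -(count_uniq_mem _ uR); apply: eq_in_count => b /removal_lt[bV _].
  rewrite /content /b0 [b in RHS]surjective_pairing /= xpair_eqE andbC.
  by apply/idP/idP; lia.
have := @removal_disj b0; rewrite /b0; case: (_ \in R) => [/(_ isT)/negbTE->//|_].
by rewrite orbF addn0.
Qed.

Hypothesis c_gt0 : 0 < c.

Lemma removal_count_residue k : k < c -> count (fun b => content b %% c == k) R = 1.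
Proof.
have [[uR sR] _ _ _ _] := rem; move=> kc.
have uniq_res : uniq [seq content b %% c | b <- R].
  rewrite map_inj_in_uniq // => b b' bR b'R; exact: removal_residue.
have [||_ eqm] := @uniq_min_size _ [seq content b %% c | b <- R] (iota 0 c) uniq_res.
- by move=> _ /mapP[b _ ->]; rewrite mem_iota /= ltn_mod.
- by rewrite size_iota size_map sR.
rewrite -(count_map (fun b => content b %% c) (pred1 k)) (count_uniq_mem _ uniq_res).
by rewrite eqm mem_iota /= kc.
Qed.

End Removal.
End Rimhooks.

(** The number of beads on a runner of the [c]-abacus, the beads being the south steps. *)
Definition runner c w (k : nat) := \sum_(j < size w) nth false w j * (j %% c == k).

(** * Rimhook removal on the abacus *)

Section Cores.
Variables (V U c : nat).
Hypothesis c_gt0 : 0 < c.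
Implicit Types (la mu nu : seq nat) (w : seq bool) (b : nat * nat).
Notation fits := (fits V U).
Notation word := (word V U).
Notation diag := (content V).

(** A south step is a time at which [easts] does not grow. Removing a rimhook lowers the sum of
    [easts] over the times of residue [k] by one, and likewise over their successors, since its
    contents meet each residue once. *)
Lemma removal_runner la nu (k : nat) : fits la -> removes_rimhook c la nu ->
  runner c (word nu) k = runner c (word la) k.
Proof.
move=> fla [R rem]; have fnu := removal_fits fla rem.
have [kc|ck] := ltnP k c; last first.
  rewrite /runner !big1 // => j _; case: eqP => [e|]; rewrite ?muln0 //;
  by have := ltn_pmod j c_gt0; rewrite e ltnNge ck.
have step mu : fits mu -> runner c (word mu) k +
    \sum_(j < V + U) (j %% c == k) * easts (word mu) j.+1 =
    \sum_(j < V + U) (j %% c == k) * (easts (word mu) j).+1.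
  move=> fmu; rewrite /runner size_word // -big_split; apply: eq_bigr => j _ /=.
  rewrite eastsS ?size_word //; case: (nth _ _ _); case: (_ == _) => /=; lia.
have sumR (m : nat) : m <= 1 -> \sum_(j < V + U) (j %% c == k) *
    count (fun b => diag b == j + m) R = 1.
  move=> m1; pose k' := (k + m) %% c.
  rewrite -(removal_count_residue fla rem c_gt0 (k := k')) ?ltn_mod //.
  have : {subset R <= [pred b | m <= diag b < V + U + m]}.
    move=> b /(removal_lt fla rem)[b1 b2]; rewrite inE /content; lia.
  elim: (R) => [|b R' IHR] sub /=; first by rewrite big1 // => j _; rewrite muln0.
  rewrite -IHR; last by move=> b' b'R; apply: sub; rewrite in_cons b'R orbT.
  have /andP[mb bm] : m <= diag b < V + U + m by apply: sub; rewrite mem_head.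
  under eq_bigr => j _ do rewrite mulnDr.
  rewrite big_split /=; congr (_ + _).
  have jb : diag b - m < V + U by lia.
  rewrite (bigD1 (Ordinal jb)) //= subnK // eqxx muln1 big1 ?addn0 => [|j].
    rewrite /k' -[in RHS](subnK mb) eqn_modDr.
    by rewrite [k %% c]modn_small.
  by rewrite -val_eqE /= => ne; rewrite (_ : _ == j + m = false) ?muln0 //; lia.
have e1 : \sum_(j < V + U) (j %% c == k) * easts (word la) j.+1 =
    \sum_(j < V + U) (j %% c == k) * easts (word nu) j.+1 + 1.
  rewrite -(sumR 1) // -big_split; apply: eq_bigr => j _ /=.
  by rewrite (removal_easts fla rem) mulnDr addn1.
have e0 : \sum_(j < V + U) (j %% c == k) * (easts (word la) j).+1 =
    \sum_(j < V + U) (j %% c == k) * (easts (word nu) j).+1 + 1.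
  rewrite -(sumR 0) // -big_split; apply: eq_bigr => j _ /=.
  by rewrite (removal_easts fla rem) -addSn mulnDr addn0.
by have := step la fla; have := step nu fnu; lia.
Qed.

Section Swap.
Variables (w : seq bool) (i : nat).
Hypotheses (icw : i + c < size w) (wi : ~~ nth false w i) (wic : nth false w (i + c)).

(** On the abacus, the bead at [i + c] slides to the free place [i]. *)
Definition swapped : seq bool :=
  mkseq (fun j => if j == i then true else if j == i + c then false
                  else nth false w j) (size w).

Lemma size_swapped : size swapped = size w. Proof. exact: size_mkseq. Qed.

Lemma easts_swapped j : easts swapped j + (i < j <= i + c) = easts w j.
Proof.
have small k : k <= size w -> easts swapped k + (i < k <= i + c) = easts w k.
  elim: k => [|k IHk] kw; first by rewrite !easts0.
  rewrite !eastsS ?size_swapped // nth_mkseq // -(IHk (ltnW kw)).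
  case: eqP => [->|ki]; first by rewrite wi /=; lia.
  by case: eqP => [->|kic]; [rewrite wic /=|]; lia.
have [jw|wj] := leqP j (size w); first exact: small.
have jw := ltnW wj; rewrite [in RHS]easts_over // [in LHS]easts_over ?size_swapped //.
have := small _ (leqnn _); have := easts_size w; have := easts_size swapped.
by rewrite size_swapped; lia.
Qed.

Lemma countN_swapped : count negb swapped = count negb w.
Proof. by rewrite -!easts_size size_swapped -(easts_swapped (size w)); lia. Qed.

Lemma count_swapped : count id swapped = count id w.
Proof.
have := count_id_negb swapped; have := count_id_negb w.
by rewrite countN_swapped size_swapped; lia.
Qed.
End Swap.

Lemma path_up (T : eqType) (e : rel T) (f : nat -> T) a n :
  (forall j, a <= j < a + n -> e (f j) (f j.+1)) ->
  path e (f a) [seq f j | j <- iota a.+1 n] /\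
  last (f a) [seq f j | j <- iota a.+1 n] = f (a + n).
Proof.
elim: n a => [|n IHn] a he /=; first by rewrite addn0.
have [|-> ->] := IHn a.+1; first by move=> j jn; apply: he; lia.
by rewrite he ?addSnnS //; lia.
Qed.

Lemma path_down (T : eqType) (e : rel T) (f : nat -> T) a n :
  (forall j, a <= j < a + n -> e (f j.+1) (f j)) ->
  path e (f (a + n)) [seq f j | j <- rev (iota a n)] /\
  last (f (a + n)) [seq f j | j <- rev (iota a n)] = f a.
Proof.
elim: n => [|n IHn] he; first by rewrite addn0.
have [|p1 p2] := IHn; first by move=> j jn; apply: he; lia.
rewrite -addn1 iotaD rev_cat /= p1 p2 andbT; split=> //.
by rewrite addnA addn1 he //; lia.
Qed.

(** Sliding a bead removes the boxes along the path at the times from [i.+1] to [i + c]. *)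
Lemma rimhook_exists la i : fits la ->
  i + c < size (word la) -> ~~ nth false (word la) i ->
  nth false (word la) (i + c) -> exists nu, removes_rimhook c la nu.
Proof.
move=> fla; set w := word la => icw wi wic; pose w' := swapped w i.
have Vw : count id w = V by exact: count_word.
have Uw : count negb w = U by exact: countN_word.
have V' : count id w' = V by rewrite count_swapped.
have U' : count negb w' = U by rewrite countN_swapped.
have sw : size w = V + U by rewrite size_word.
pose nu := pos_parts (rows w'); have fnu : fits nu by exact: pos_parts_fits.
have wnu : word nu = w' by exact: word_pos_parts.
(* The outermost box on diagonal [j]. The predecessors are genuine by [rng], thanks to the east step
   at [i] and the south step at [i + c]. *)
pose corner j := ((souths w j).-1, (easts w j).-1).
pose R := [seq corner j | j <- iota i.+1 c].
have rng j : i < j <= i + c ->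
    [/\ 0 < easts w j, 0 < souths w j & easts w j + V = j + souths w j].
  move=> /andP[ij jic]; have jw : j <= size w by lia.
  split.
  - rewrite (leq_trans _ (_ : easts w i.+1 <= _)) //; first by rewrite eastsS ?wi; lia.
    by rewrite /easts -(subnKC ij) takeD count_cat leq_addr.
  - rewrite (leq_trans _ (_ : souths w (i + c) <= _)) //.
      by rewrite southsS ?wic //; lia.
    rewrite /souths -{1}(subnK jic) -drop_drop.
    by rewrite -[X in _ <= count _ X](cat_take_drop (i + c - j)) count_cat leq_addl.
  - by rewrite -Vw -souths0 easts_souths.
have content_corner j : i < j <= i + c -> diag (corner j) = j.
  by move=> /rng[]; rewrite /content /=; lia.
have mem_iotaE j : (j \in iota i.+1 c) = (i < j <= i + c).
  by rewrite mem_iota; lia.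
have map_content : [seq diag b | b <- R] = iota i.+1 c.
  rewrite -map_comp -[RHS]map_id; apply/eq_in_map => j.
  by rewrite mem_iotaE => /content_corner.
have R_P b : b \in R -> exists2 j, i < j <= i + c & b = corner j.
  by move=> /mapP[j]; rewrite mem_iotaE; exists j.
have southsV j : souths w j <= V.
  rewrite -Vw -souths0 /souths drop0.
  by rewrite -[X in _ <= count _ X](cat_take_drop j) count_cat leq_addl.
have RV b : b \in R -> b.1 < V.
  by move=> /R_P[j /rng[_ d0 _] ->] /=; have := southsV j; lia.
exists nu, R; split.
- split; last by rewrite size_map size_iota.
  by apply: (@map_uniq _ _ diag); rewrite map_content iota_uniq.
- move=> b bR; have bV := RV _ bR; have [j jr e] := R_P _ bR.
  rewrite [b]surjective_pairing (mem_boxes_word _ fla bV) -/w.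
  rewrite -/(diag b) e content_corner //=.
  by have [] := rng _ jr; lia.
- have adj j : i < j < i + c -> adjacent (corner j) (corner j.+1).
    move=> jr; have [|u0 d0 _] := rng j; first lia.
    have [|u1 d1 _] := rng j.+1; first lia.
    have jw : j < size w by lia.
    rewrite /adjacent /corner /=; move: u0 d0 u1 d1.
    rewrite eastsS // (southsS jw); case: (nth false w j) => /=; lia.
  have adjC : symmetric adjacent.
    by move=> b b'; rewrite /adjacent; lia.
  move=> _ _ /R_P[j1 jr1 ->] /R_P[j2 jr2 ->].
  have [le12|lt21] := leqP j1 j2.
    have [|pth lst] := @path_up _ adjacent corner j1 (j2 - j1).
      by move=> j jr; apply: adj; lia.
    exists [seq corner j | j <- iota j1.+1 (j2 - j1)].
    split=> //; last by rewrite lst subnKC.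
    by apply/allP => _ /mapP[j jr ->]; apply: map_f; move: jr; rewrite !mem_iota; lia.
  have [|pth lst] := @path_down _ adjacent corner j2 (j1 - j2).
    by move=> j jr; rewrite adjC; apply: adj; lia.
  rewrite subnKC 1?ltnW // in pth lst.
  exists [seq corner j | j <- rev (iota j2 (j1 - j2))]; split=> //.
  apply/allP => _ /mapP[j jr ->]; apply: map_f; move: jr.
  by rewrite mem_rev !mem_iota; lia.
- move=> y x; apply/negP => /and4P[b1 _ _ b2].
  have [j1 jr1 e1] := R_P _ b1; have [j2 jr2 e2] := R_P _ b2.
  have c1 := content_corner _ jr1; have c2 := content_corner _ jr2.
  have y1 := RV _ b2; rewrite /= in y1.
  have j12 : j1 = j2 by rewrite -c1 -c2 -e1 -e2 /content /=; lia.
  by move: e1 e2; rewrite -j12 => <- [e _]; lia.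
- split; first by case/and3P: fnu.
  move=> b; rewrite mem_filter.
  have [bV|Vb] := ltnP b.1 V; last first.
    have nb mu : fits mu -> b \in boxes mu = false.
      by move=> fmu; apply/negP => /(fits_lt fmu)[]; rewrite ltnNge Vb.
    by rewrite !nb // andbF.
  have mb mu : fits mu -> (b \in boxes mu) = (b.2 < easts (word mu) (diag b)).
    by move=> fmu; rewrite {1}[b]surjective_pairing (mem_boxes_word _ fmu bV).
  rewrite !mb // wnu -/w.
  have := easts_swapped icw wi wic (diag b); rewrite -/w' => eup.
  have -> : (b \in R) = (i < diag b <= i + c) && (b.2.+1 == easts w (diag b)).
    apply/idP/andP => [/R_P[j jr ->]|[jr /eqP ub]].
      rewrite content_corner //; split => //=.
      by have [u0 _ _] := rng _ jr; rewrite prednK.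
    apply/mapP; exists (diag b); first by rewrite mem_iotaE.
    have [u0 d0 e] := rng _ jr.
    rewrite /corner -ub /= [b in LHS]surjective_pairing; congr (_, _).
    move: e d0 bV; rewrite -ub /content.
    by case: (b) => b1 b2 /=; lia.
  move: eup; lia.
Qed.
End Cores.

(** * Cores as flush abaci *)

Section FlushWords.
Variable c : nat.
Hypothesis c_gt0 : 0 < c.

(** On each runner all beads come before all free places. *)
Definition flush w :=
  forall i, i + c < size w -> ~~ nth false w i -> ~~ nth false w (i + c).

Lemma flush_mul w i k : flush w -> i + k * c < size w ->
  ~~ nth false w i -> ~~ nth false w (i + k * c).
Proof.
move=> fw; elim: k => [|k IHk] ik wi; first by rewrite addn0.
rewrite mulSn addnCA addnC; apply: fw; first by move: ik; rewrite mulSn; lia.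
by apply: IHk => //; move: ik; rewrite mulSn; lia.
Qed.

(** If [j] were a bead of [w] only, then on its runner [w] would have all the places up to [j] and
    [w'] only places before [j], against equal bead numbers. *)
Lemma flush_le w w' j : size w = size w' -> flush w -> flush w' ->
  runner c w (j %% c) = runner c w' (j %% c) -> j < size w ->
  nth false w j -> nth false w' j.
Proof.
move=> sz fw fw' run jw wj; apply: contraT => w'j.
have : runner c w' (j %% c) < runner c w (j %% c); last by rewrite run ltnn.
rewrite /runner -sz (bigD1 (Ordinal jw)) //= [X in _ < X](bigD1 (Ordinal jw)) //=.
rewrite wj (negbTE w'j) eqxx /= add0n add1n ltnS; apply: leq_sum => i _.
have iw := ltn_ord i; case: eqP => [e|]; last by rewrite !muln0.
rewrite !muln1; case: (leqP i j) => [le|/ltnW le].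
  have wi : nth false w i.
    apply: contraT => wi; have /dvdnP[q eq] : c %| j - i by rewrite -eqn_mod_dvd // e.
    by have := @flush_mul w i q fw; rewrite -eq subnKC // wj => /(_ jw wi).
  by rewrite wi; case: (nth _ _ _).
have /dvdnP[q eq] : c %| i - j by rewrite -eqn_mod_dvd // e.
have := @flush_mul w' j q fw'; rewrite -eq subnKC // -sz => /(_ iw w'j)/negbTE->.
by [].
Qed.

Lemma flush_inj w w' : size w = size w' -> flush w -> flush w' ->
  (forall k, runner c w k = runner c w' k) -> w = w'.
Proof.
move=> sz fw fw' run; apply: (eq_from_nth (x0 := false)) => // j jw.
by apply/idP/idP; apply: flush_le; rewrite // -?sz.
Qed.
End FlushWords.

Section CoreTransfer.
Variables (V U c : nat).
Hypothesis c_gt0 : 0 < c.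
Notation fits := (fits V U).
Notation word := (word V U).

Lemma core_flush la : fits la -> is_core c la -> flush c (word la).
Proof.
move=> fla [_ nrem] i ic wi; apply/negP => wic; apply: nrem.
exact: (@rimhook_exists V U c c_gt0 la i).
Qed.

Lemma core_unique mu mu' : fits mu -> fits mu' -> is_core c mu -> is_core c mu' ->
  (forall k, runner c (word mu) k = runner c (word mu') k) -> mu = mu'.
Proof.
move=> fm fm' cm cm' run; rewrite -(pos_parts_word fm) -(pos_parts_word fm').
congr (pos_parts (rows _)); apply: (flush_inj c_gt0) => //.
- by rewrite !size_word.
- exact: core_flush.
- exact: core_flush.
Qed.

Lemma reduction_invariant la nu : fits la ->
  clos_refl_trans _ (removes_rimhook c) la nu ->
  fits nu /\ forall k, runner c (word nu) k = runner c (word la) k.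
Proof.
move=> + red; elim: red => [{}la {}nu rem fla|{}la //|x y z _ IH1 _ IH2 fx].
  split; last by move=> k; exact: removal_runner.
  by case: rem => R; exact: removal_fits.
have [fy r1] := IH1 fx; have [fz r2] := IH2 fy; split=> // k.
by rewrite r2 r1.
Qed.

(** The termination measure for [core_exists]. *)
Lemma removal_sum_easts la nu : fits la -> removes_rimhook c la nu ->
  \sum_(j < V + U) easts (word nu) j < \sum_(j < V + U) easts (word la) j.
Proof.
move=> fla [R rem]; have [[_ sR] _ _ _ _] := rem.
have [b bR] : exists b, b \in R.
  by case: (R) sR c_gt0 => [<-//|b R' _ _]; exists b; rewrite mem_head.
have [b1 b2] := removal_lt fla rem bR.
have cb : content V b < V + U by rewrite /content; lia.
rewrite (bigD1 (Ordinal cb)) //= [X in _ < X](bigD1 (Ordinal cb)) //=.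
rewrite -addSn leq_add //; last first.
  by apply: leq_sum => j _; rewrite (removal_easts fla rem) leq_addr.
rewrite (removal_easts fla rem) -addn1 leq_add2l -has_count.
by apply/hasP; exists b.
Qed.

Lemma core_exists la : fits la -> exists mu, has_core c la mu.
Proof.
move=> fla; have [m] := ubnP (\sum_(j < V + U) easts (word la) j).
elim: m la fla => // m IHm la fla; rewrite ltnS => lem.
have [[nu rem]|nrem] := pselect (exists nu, removes_rimhook c la nu); last first.
  exists la; split; [exact: rt_refl|split=> //].
  by case/and3P: fla.
have [||mu [red cmu]] := IHm nu.
- by case: rem => R; exact: removal_fits.
- exact: leq_trans (removal_sum_easts fla rem) lem.
by exists mu; split=> //; apply: rt_trans red; exact: rt_step.
Qed.

(** Reduction preserves the bead numbers, and these determine a flush word, hence the core. *)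
Lemma has_core_transfer la la' mu : fits la -> fits la' ->
  (forall k, runner c (word la) k = runner c (word la') k) ->
  has_core c la mu -> has_core c la' mu.
Proof.
move=> fla fla' run [red cmu]; have [mu' [red' cmu']] := core_exists fla'.
have [fm rm] := reduction_invariant fla red.
have [fm' rm'] := reduction_invariant fla' red'.
by rewrite (core_unique fm fm' cmu cmu') // => k; rewrite rm rm' run.
Qed.
End CoreTransfer.

(** * The theorem *)

(** The rectangle cut off by a point of the path lies inside the diagram. *)
Lemma easts_mul_souths w j : easts w j * souths w j <= sumn (rows w).
Proof.
elim/last_ind: w j => [|w l IHw] j; first by rewrite /easts.
have [jw|wj] := leqP j (size w); last first.
  by rewrite /souths drop_oversize ?size_rcons // muln0.
rewrite easts_rcons // souths_rcons // rows_rcons mulnDr addnC.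
case: l => /=; last by rewrite muln0 add0n.
by rewrite muln1 leq_add // easts_le.
Qed.

(** At successive south steps, [souths] runs down from their total number to 1. *)
Lemma sum_souths w : \sum_(j < size w) nth false w j * souths w j =
  \sum_(k < (count id w).+1) k.
Proof.
elim: w => [|l w IHw]; first by rewrite big_ord0 big_ord1.
rewrite [LHS]big_ord_recl [X in _ + X]IHw [souths _ _]souths0 /=.
by case: l; rewrite /= ?add0n // [RHS]big_ord_recr mul1n add1n addnC.
Qed.

Section Fractions.
Variables (x : rat) (r s : nat).
Hypotheses (s_gt0 : 0 < s) (xE : (x = r%:R / s%:R)%R).

Lemma frac_le a l : (Defs.frac a l.+1 <= x%:E)%E = (s * a <= r * l.+1).
Proof.
rewrite /Defs.frac /= lee_fin xE ler_pdivrMr ?ltr0n // mulrAC ler_pdivlMr ?ltr0n //.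
by rewrite -!natrM ler_nat mulnC.
Qed.

Lemma frac_lt a l : (Defs.frac a l.+1 < x%:E)%E = (s * a < r * l.+1).
Proof.
rewrite /Defs.frac /= lte_fin xE ltr_pdivrMr ?ltr0n // mulrAC ltr_pdivlMr ?ltr0n //.
by rewrite -!natrM ltr_nat mulnC.
Qed.

(** The infinite value at [l = 0] agrees with the cleared inequality because [s] is positive. *)
Lemma lt_frac a l : (x%:E < Defs.frac a.+1 l)%E = (r * l < s * a.+1).
Proof.
case: l => [|l]; first by rewrite /Defs.frac /= ltry muln0 muln_gt0 s_gt0.
by rewrite ltNge frac_le ltnNge.
Qed.

Lemma le_frac a l : (x%:E <= Defs.frac a.+1 l)%E = (r * l <= s * a.+1).
Proof.
case: l => [|l]; first by rewrite /Defs.frac /= leey muln0.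
by rewrite leNgt frac_lt -leqNgt.
Qed.
End Fractions.

Lemma easts_mono w i j : i <= j -> easts w i <= easts w j.
Proof. by move=> ij; rewrite /easts -(subnKC ij) takeD count_cat leq_addr. Qed.

Lemma souths_mono w i j : i <= j -> souths w j <= souths w i.
Proof.
move=> ij; rewrite /souths -(subnK ij) -drop_drop.
by rewrite -[X in _ <= count _ X](cat_take_drop (j - i)) count_cat leq_addl.
Qed.

Lemma hplusE (x : \bar rat) c la : hplus x c la = box_stat (fun a l =>
  [&& c %| (a + l).+1, (Defs.frac a l.+1 <= x)%E & (x < Defs.frac a.+1 l)%E]) la.
Proof. by []. Qed.

Lemma hminusE (x : \bar rat) c la : hminus x c la = box_stat (fun a l =>
  [&& c %| (a + l).+1, (Defs.frac a l.+1 < x)%E & (x <= Defs.frac a.+1 l)%E]) la.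
Proof. by []. Qed.

(** * The two box statistics read on the path *)

Section Statistics.
Variables (x : rat) (r s C : nat).
Hypotheses (s_gt0 : 0 < s) (r_gt0 : 0 < r) (xE : (x = r%:R / s%:R)%R).

Lemma hook_pair w i j : i < j -> j < size w ->
  ~~ nth false w i -> nth false w j ->
  (easts w j - easts w i.+1) + (souths w i.+1 - souths w j) = (j - i).-1 /\
  level s r w j + r * (souths w i.+1 - souths w j) =
    level s r w i + s * (easts w j - easts w i.+1).+1.
Proof.
move=> ij jw wi wj; have iw := ltn_trans ij jw.
have um := easts_mono w ij; have dm := souths_mono w ij.
have ei := easts_souths (ltnW iw); have ej := easts_souths (ltnW jw).
have Di := southsS iw; have Ui := eastsS iw; rewrite (negbTE wi) /= in Di Ui.
split; first by lia.
rewrite /level; move: um dm Di Ui.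
move: (easts w j) (easts w i.+1) (easts w i) (souths w j) (souths w i.+1) (souths w i) => *.
nia.
Qed.

(** By [hook_pair] the slope conditions say that the level gap is positive and at most [r + s]. The
    gap [r + s] means arrival at the same level; smaller gaps form [mid_stat]. *)
Lemma hplus_rows w :
  hplus x%:E C.+1 (rows w) = mid_stat s r C w + entry_stat s r C w.
Proof.
rewrite hplusE box_stat_rows /path_stat /mid_stat /entry_stat -big_split.
apply: eq_bigr => j _ /=.
rewrite -big_split; apply: eq_bigr => i _ /=; have jw := ltn_ord j.
case: (ltnP i j) => //= ij; case wi: (nth false w i) => //=; case wj: (nth false w j) => //=.
have [eh el] := hook_pair ij jw (negbT wi) wj.
rewrite (frac_le s_gt0 xE) (lt_frac s_gt0 xE) eh prednK ?subn_gt0 //.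
have -> : (C.+1 %| j - i) = (i == j %[mod C.+1]).
  by rewrite eq_sym eqn_mod_dvd // ltnW.
rewrite /near_below; case: (i == j %[mod _]); last by rewrite !andbF.
rewrite !andbT /=.
have := levelS s r (ltn_trans ij jw); have := levelS s r jw; rewrite wi wj /=.
move: el; rewrite !mulnS.
move: (level _ _ _ _) (level _ _ _ _) (level _ _ _ _) (level _ _ _ _) => a b c d.
move: (s * _) (r * _) => e f; lia.
Qed.

(** Here the gap is nonnegative and less than [r + s]; gap 0 means departure from the same level. *)
Lemma hminus_rows w :
  hminus x%:E C.+1 (rows w) = mid_stat s r C w + exit_stat s r C w.
Proof.
rewrite hminusE box_stat_rows /path_stat /mid_stat /exit_stat -big_split.
apply: eq_bigr => j _ /=.
rewrite -big_split; apply: eq_bigr => i _ /=; have jw := ltn_ord j.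
case: (ltnP i j) => //= ij; case wi: (nth false w i) => //=; case wj: (nth false w j) => //=.
have [eh el] := hook_pair ij jw (negbT wi) wj.
rewrite (frac_lt s_gt0 xE) (le_frac s_gt0 xE) eh prednK ?subn_gt0 //.
have -> : (C.+1 %| j - i) = (i == j %[mod C.+1]).
  by rewrite eq_sym eqn_mod_dvd // ltnW.
rewrite /near_below; case: (i == j %[mod _]); last by rewrite !andbF.
rewrite !andbT /=.
have := levelS s r (ltn_trans ij jw); have := levelS s r jw; rewrite wi wj /=.
move: el; rewrite !mulnS.
move: (level _ _ _ _) (level _ _ _ _) (level _ _ _ _) (level _ _ _ _) => a b c d.
move: (s * _) (r * _) => e f; lia.
Qed.
End Statistics.

Local Open Scope ring_scope.

Lemma sum_by_fibers (R : nmodType) (T : finType) (K : eqType) (key : T -> K)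
    (S : {set T}) (f g : T -> R) :
  (forall w w', w \in S -> key w' = key w -> w' \in S) ->
  (forall w, w \in S ->
     \sum_(w' | key w' == key w) f w' = \sum_(w' | key w' == key w) g w') ->
  \sum_(w in S) f w = \sum_(w in S) g w.
Proof.
move=> closed eqfg; pose cls w := [set w' | key w' == key w].
rewrite (partition_big cls predT) // [RHS](partition_big cls predT) //.
apply: eq_bigr => A _.
have [w0 /andP[w0S /eqP <-]|none] := pickP (fun w => (w \in S) && (cls w == A)); last first.
  by rewrite !big_pred0.
have fiberE h : \sum_(w | (w \in S) && (cls w == cls w0)) h w =
    \sum_(w | key w == key w0) h w :> R.
  apply: eq_bigl => w; apply/andP/eqP => [[_ /eqP/setP/(_ w)]|kw].
    by rewrite !inE eqxx => /esym/eqP.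
  by split; [exact: closed kw | rewrite /cls kw].
by rewrite !fiberE eqfg.
Qed.

(** As a polynomial it takes the value [k.+1] at 1. *)
Lemma qint_X_neq0 k : qint (tofrac 'X : {fraction {poly int}}) k.+1 != 0.
Proof.
rewrite /qint; under eq_bigr => i _ do rewrite -rmorphXn.
rewrite -rmorph_sum tofrac_eq0; apply/eqP => /(congr1 (fun p => p.[1])).
rewrite horner_sum horner0; under eq_bigr => i _ do rewrite hornerXn expr1n.
by rewrite sumr_const card_ord => /eqP; rewrite pnatr_eq0.
Qed.

(** * Partitions with a given core as a union of tour classes *)

Section Assembly.
Variables (C : nat) (mu : seq nat) (x : rat) (r s n : nat).
Hypotheses (s_gt0 : (0 < s)%N) (r_gt0 : (0 < r)%N) (xE : x = r%:R / s%:R).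

(* Large enough for the path of a partition of [n] to stay below the line of
   slope [- 1 / x] joining the ends of the path. *)
Definition scale := (C.+1 * ((r + s) * n).+1)%N.
Local Notation V := (s * scale)%N.
Local Notation U := (r * scale)%N.
Local Notation L := (r * V)%N.
Local Notation N := (V + U)%N.
Notation same_tour := (same_tour s r C L).
Notation bounded := (bounded s r C L).
Notation fits := (fits V U).
Notation word := (word V U).

Lemma scale_ge : ((r + s) * n <= scale)%N.
Proof. by rewrite /scale mulSn; lia. Qed.

Lemma partn_fits (la : Defs.partn n) : fits la.
Proof.
case: la => la /= /andP[pla /eqP sla]; apply: (@sum_fits _ _ n) => //; first by rewrite sla.
  by have := scale_ge; nia.
by have := scale_ge; nia.
Qed.

Lemma word_bounded la : fits la -> (sumn la <= n)%N -> bounded (word la).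
Proof.
move=> fla sla; have wV := count_word fla; have wU := countN_word fla.
split.
- rewrite size_word // -mulnDl; apply: dvdn_mull; exact: dvdn_mulr.
- by rewrite /level easts0 souths0 wV muln0.
- by rewrite /level souths_size easts_size wU; lia.
move=> j jw; have := easts_mul_souths (word la) j.
rewrite rows_word // sumn_pad => area.
have uU : (easts (word la) j <= U)%N by have := easts_le (word la) j; rewrite wU.
have dV : (souths (word la) j <= V)%N.
  by have := @souths_mono (word la) 0 j (leq0n _); rewrite souths0 wV.
have sc := scale_ge; rewrite /level; move: area uU dV.
move: (easts _ _) (souths _ _) => u v area uU vV.
case: (posnP u) => [->|u0]; first by rewrite muln0 leq_mul2l vV orbT.
case: (posnP v) => [->|v0].
  by rewrite muln0 addn0 [(r * V)%N]mulnCA leq_mul2l uU orbT.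
(* When both are positive, the area bound makes each at most [n], so the level is at most
   [(r + s) * n], hence at most [scale]. *)
have un : (u <= n)%N by nia.
have vn : (v <= n)%N by nia.
apply: (@leq_trans ((r + s) * n)%N); first by nia.
by apply: leq_trans sc _; nia.
Qed.

Lemma size_wordE la : fits la -> size (word la) == N.
Proof. by move=> fla; rewrite size_word. Qed.

Definition tword (la : Defs.partn n) : N.-tuple bool := Tuple (size_wordE (partn_fits la)).

Lemma tword_inj : injective tword.
Proof.
move=> la la' /(congr1 val) /= e; apply: val_inj.
by rewrite -[LHS](pos_parts_word (partn_fits la)) e [LHS](pos_parts_word (partn_fits la')).
Qed.

Definition core_words : {set N.-tuple bool} := [set tword la | la in Par C.+1 mu n].

Lemma core_wordsP (w : N.-tuple bool) : reflect
  (exists la, [/\ fits la, sumn la = n, has_core C.+1 la mu & word la = w])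
  (w \in core_words).
Proof.
apply: (iffP imsetP) => [[la] | [la [fla sla core wla]]].
  rewrite inE => /asboolP core ->; exists la; split=> //; first exact: partn_fits.
  by case: la {core} => la /= /andP[_ /eqP].
have pla : is_partition la && (sumn la == n).
  by rewrite sla eqxx andbT; case/and3P: fla.
exists (Partn pla); first by rewrite inE; apply/asboolP.
exact: val_inj.
Qed.

Lemma core_words_bounded w : w \in core_words -> bounded w.
Proof.
by move=> /core_wordsP[la [fla sla _ <-]]; apply: word_bounded; rewrite ?sla.
Qed.

(** Size and bead numbers are read from sums over the south steps of functions of level and residue,
    to which [same_tour_sum] applies. *)
Lemma same_tour_core_words (w0 w : N.-tuple bool) :
  w0 \in core_words -> same_tour w0 w -> w \in core_words.
Proof.
move=> w0S st; have bw0 := core_words_bounded w0S.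
have sz : size w = size w0 by rewrite !size_tuple.
have [la0 [fla0 sla0 core0 w0E]] := core_wordsP _ w0S.
have wV : count id w = V by rewrite (same_tour_count st) -w0E count_word.
have wU : count negb w = U.
  by have := count_id_negb w; rewrite size_tuple wV; lia.
have fla := pos_parts_fits wV wU; have wla := word_pos_parts wV wU.
apply/core_wordsP; exists (pos_parts (rows w)); split=> //.
  rewrite -[LHS](sumn_pad V) pad_pos_parts ?rows_sorted ?size_rows //.
  transitivity (sumn (rows w0)); last by rewrite -w0E rows_word // sumn_pad.
  rewrite !sumn_rows.
  (* The levels at the south steps add up to [s] times the size plus a constant, by [sum_souths]. *)
  have level_sum (w' : seq bool) :
      (\sum_(j < size w') (nth false w' j == true) * level s r w' j =
      s * (\sum_(j < size w') nth false w' j * easts w' j) +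
      r * (\sum_(k < (count id w').+1) k))%N.
    rewrite -sum_souths !big_distrr -big_split; apply: eq_bigr => j _ /=.
    by rewrite /level eqb_id mulnDr mulnCA [X in (_ + X)%N]mulnCA.
  have := same_tour_sum s_gt0 r_gt0 true (fun l _ => l) sz st bw0.
  rewrite !level_sum wV -w0E count_word // w0E => /addIn/eqP.
  by rewrite eqn_pmul2l // => /eqP.
apply: (has_core_transfer (c := C.+1) _ fla0 fla) core0 => // k.
rewrite wla w0E /runner.
have := same_tour_sum s_gt0 r_gt0 true (fun _ p => (p == k) : nat) sz st bw0.
by under eq_bigr => j _ do rewrite eqb_id; under [RHS]eq_bigr => j _ do rewrite eqb_id.
Qed.

(** On a class [mid_stat] is constant and factors out; the rest is compared in the fraction field,
    where [t]-integers are invertible. *)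
Lemma class_equidistributed (w0 : N.-tuple bool) : w0 \in core_words ->
  \sum_(w : N.-tuple bool | tour_key s r C L w == tour_key s r C L w0)
    'X^(hplus x%:E C.+1 (rows w)) =
  \sum_(w : N.-tuple bool | tour_key s r C L w == tour_key s r C L w0)
    'X^(hminus x%:E C.+1 (rows w)) :> {poly int}.
Proof.
move=> w0S; have bw0 := core_words_bounded w0S.
rewrite !(eq_bigl _ _ ((fun w : N.-tuple bool => tour_keyE s r C L w w0))).
have mid_eq (w : N.-tuple bool) :
    same_tour w0 w -> mid_stat s r C w = mid_stat s r C w0.
  by move=> st; apply: (same_tour_mid s_gt0 r_gt0 _ st bw0); rewrite !size_tuple.
transitivity ('X^(mid_stat s r C w0) * \sum_(w : N.-tuple bool | same_tour w0 w)
    'X^(entry_stat s r C w) : {poly int}).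
  rewrite big_distrr; apply: eq_bigr => w st /=.
  by rewrite (hplus_rows C s_gt0 r_gt0 xE) mid_eq // exprD.
transitivity ('X^(mid_stat s r C w0) * \sum_(w : N.-tuple bool | same_tour w0 w)
    'X^(exit_stat s r C w) : {poly int}); last first.
  rewrite big_distrr; apply: eq_bigr => w st /=.
  by rewrite (hminus_rows C s_gt0 r_gt0 xE) mid_eq // exprD.
congr (_ * _); apply/eqP; rewrite -tofrac_eq !rmorph_sum /=; apply/eqP.
under eq_bigr => w _ do rewrite rmorphXn.
under [RHS]eq_bigr => w _ do rewrite rmorphXn.
symmetry; apply: same_tour_equidistributed => //; first exact: qint_X_neq0.
by rewrite tofrac_eq0 polyX_eq0.
Qed.

Lemma core_sumE (h : seq nat -> nat) : (forall la, fits la -> h (pad V la) = h la) ->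
  \sum_(la in Par C.+1 mu n) 'X^(h la) =
  \sum_(w in core_words) 'X^(h (rows w)) :> {poly int}.
Proof.
move=> hpad; rewrite big_imset; last by move=> ? ? _ _; exact: tword_inj.
apply: eq_bigr => la _ /=; have fla := partn_fits la.
by rewrite rows_word // hpad.
Qed.

Lemma core_equidistributed :
  \sum_(la in Par C.+1 mu n) 'X^(hplus x%:E C.+1 la) =
  \sum_(la in Par C.+1 mu n) 'X^(hminus x%:E C.+1 la) :> {poly int}.
Proof.
rewrite !core_sumE => [|la _|la _].
- apply: (sum_by_fibers (key := fun w : N.-tuple bool => tour_key s r C L w));
    last exact: class_equidistributed.
  move=> w w' wS /eqP.
  by rewrite tour_keyE; exact: same_tour_core_words.
- by rewrite !hminusE box_stat_pad.
- by rewrite !hplusE box_stat_pad.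
Qed.
End Assembly.

Theorem theorem3p3 (c : nat) (mu : seq nat) (hc : (0 < c)%N)
    (hmu : is_core c mu) (x : rat) (hx : 0 < x) (n : nat) :
  \sum_(la in Par c mu n) 'X^(hplus x%:E c la)
  = \sum_(la in Par c mu n) 'X^(hminus x%:E c la) :> {poly int}.
Proof.
case: c hc hmu => // C _ _.
have nx : 0 < numq x by rewrite numq_gt0.
apply: (@core_equidistributed C mu x `|numq x|%N `|denq x|%N n).
- by rewrite absz_gt0 denq_neq0.
- by rewrite absz_gt0 gt_eqF.
- rewrite -[LHS]divq_num_den -[in LHS](gez0_abs (ltW nx)) -[in LHS](gez0_abs (denq_ge0 x)).
  by rewrite -!pmulrn.
Qed.
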